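(* Consider the operator $L=\frac12\Delta$ in the square $D=(0,1)^2$. Then there exists a jump measure $\nu$ of the form $\delta_{x_0}$, for some $x_0\in(0,1)^2$, for which $$\gamma_1(\nu)>\lambda_1^D=-\frac{5\pi^2}{2}.$$
   Context: For a probability measure $\nu$ on $D=(0,1)^2$ (the jump measure), the operator $\mathcal{L}$ is defined by $\mathcal{L}f=\frac12\Delta f$ on the domain $\{f\in C^2(\overline D): \int_D f\,d\nu=f|_{\partial D}\}$ (so $f$ is constant on $\partial D$, equal there to $\int_D f\,d\nu$; complex-valued functions allowed). A number $\lambda\in\mathbb{C}$ is an eigenvalue of $\mathcal{L}$ if there is a nonzero $f$ in this domain with $\frac12\Delta f=\lambda f$ in $D$. The spectral gap is $\gamma_1(\nu)\equiv\sup\{\mathrm{Re}\,\lambda:0\ne\lambda\text{ is an eigenvalue of }\mathcal{L}\}$. $\{\lambda_n^D\}_{n=0}^\infty$ denote the eigenvalues of $\frac12\Delta$ on $D$ with the Dirichlet boundary condition, labeled in nonincreasing order and repeated according to multiplicity. $\delta_{x_0}$ is the unit point mass at $x_0$.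
   Formalization: The domain C²(D̄) is relaxed at the four vertices: f is continuous on D̄ and its partials of order ≤ 2 extend continuously to D̄ minus the vertices; with literal C²(D̄), Δf = 0 at a vertex forces f = 0 on ∂D when λ ≠ 0, so γ₁(δ_{x0}) ≤ λ₁^D always. *)

(* Defs.v *)
From HB Require Import structures.
From mathcomp Require Import all_boot all_order all_algebra.
From mathcomp Require Import all_classical all_reals all_analysis.
From mathcomp Require Import complex.
Import Order.TTheory GRing.Theory Num.Theory.
Import numFieldNormedType.Exports.

Set Implicit Arguments.
Unset Strict Implicit.
Unset Printing Implicit Defensive.

Local Open Scope classical_set_scope.
Local Open Scope ring_scope.
Local Open Scope complex_scope.

Section Square.
Context {R : realType}.

Definition square : set (R * R) := `]0, 1[ `*` `]0, 1[.

Definition square_boundary : set (R * R) := closure square `\` square.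

Definition square_corners : set (R * R) := [set 0; 1] `*` [set 0; 1].

Definition axis (i : 'I_2) : R * R := if i == ord0 then (1, 0) else (0, 1).

Definition partial (i : 'I_2) (u : R * R -> R) : R * R -> R :=
  fun z => derive u z (axis i).

(* [g], which only matters on the open square, extends continuously to [S]. *)
Definition extends_continuously (S : set (R * R)) (g : R * R -> R) : Prop :=
  exists2 h : R * R -> R, {within S, continuous h} & {in square, g =1 h}.

(* C^2 up to the boundary.  On a domain with corners this is understood as:
   continuous on the closed square, with all partial derivatives of order at
   most 2 extending continuously to the closed square minus its vertices.
   Continuity of the second derivatives cannot be asked for at the vertices:
   a function that is constant (equal to c) on the boundary and C^2 up to a
   vertex has zero Laplacian there, so an eigenfunction for lambda <> 0 would
   satisfy lambda * c = 0, hence c = 0, which would discard every eigenfunction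
   that is not a Dirichlet one. *)
Definition C2_closure (u : R * R -> R) : Prop :=
  let S := closure square `\` square_corners in
  [/\ {within closure square, continuous u},
      forall i, (forall z, square z -> derivable u z (axis i)) /\
        extends_continuously S (partial i u)
    & forall i j,
        (forall z, square z -> derivable (partial i u) z (axis j)) /\
        extends_continuously S (partial j (partial i u))].

Definition laplacian (u : R * R -> R) : R * R -> R :=
  fun z => \sum_(i < 2) partial i (partial i u) z.

Definition reC (f : R * R -> R[i]) : R * R -> R := fun z => complex.Re (f z).
Definition imC (f : R * R -> R[i]) : R * R -> R := fun z => complex.Im (f z).

Definition C2_closureC (f : R * R -> R[i]) : Prop :=
  C2_closure (reC f) /\ C2_closure (imC f).

Definition laplacianC (f : R * R -> R[i]) : R * R -> R[i] :=
  fun z => laplacian (reC f) z +i* laplacian (imC f) z.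

(* Functions are total on R * R, but only their values on the closed square
   are meaningful. *)
Definition half_laplacian_eq (lambda : R[i]) (f : R * R -> R[i]) : Prop :=
  forall z, square z -> 2^-1 * laplacianC f z = lambda * f z.

(* [nu] is a measure on the whole plane; a jump measure is one carried by the
   open square. *)
Definition integralC (nu : probability (R * R)%type R) (f : R * R -> R[i]) :
    R[i] :=
  Rintegral nu square (reC f) +i* Rintegral nu square (imC f).

Definition jump_domain (nu : probability (R * R)%type R)
    (f : R * R -> R[i]) : Prop :=
  C2_closureC f /\ forall z, square_boundary z -> f z = integralC nu f.

Definition jump_eigenvalue (nu : probability (R * R)%type R)
    (lambda : R[i]) : Prop :=
  exists f : R * R -> R[i],
    [/\ jump_domain nu f, exists2 z, closure square z & f z != 0
      & half_laplacian_eq lambda f].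

Definition gamma1 (nu : probability (R * R)%type R) : \bar R :=
  ereal_sup [set (complex.Re lambda)%:E |
    lambda in [set lambda | lambda != 0 /\ jump_eigenvalue nu lambda]].

Definition dirichlet_eigenspace (lambda : R[i]) (f : R * R -> R[i]) : Prop :=
  [/\ C2_closureC f, forall z, square_boundary z -> f z = 0
    & half_laplacian_eq lambda f].

Definition dirichlet_eigenbasis (lambda : R[i]) (m : nat)
    (b : 'I_m -> R * R -> R[i]) : Prop :=
  (forall k, dirichlet_eigenspace lambda (b k)) /\
  forall f, dirichlet_eigenspace lambda f ->
    exists! c : {ffun 'I_m -> R[i]},
      forall z, closure square z -> f z = \sum_(k < m) c k * b k z.

(* [lam] lists the Dirichlet eigenvalues in nonincreasing order, each complex
   number mu occurring exactly as many times as the dimension of its eigenspace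
   (in particular not at all if mu is not an eigenvalue). *)
Definition dirichlet_eigenvalues (lam : nat -> R) : Prop :=
  (forall n, lam n.+1 <= lam n) /\
  forall mu : R[i], exists m (b : 'I_m -> R * R -> R[i]),
    dirichlet_eigenbasis mu b /\ ([set n | (lam n)%:C = mu] #= `I_m)%card.

End Square.

(* Main.v *)
Require Import Defs.
From mathcomp Require Import all_boot all_order all_algebra.
From mathcomp Require Import all_classical all_reals all_analysis.
From mathcomp Require Import complex measurable_realfun ring lra.
Import Order.TTheory GRing.Theory Num.Theory.
Import numFieldNormedType.Exports.
Set Implicit Arguments.
Unset Strict Implicit.
Unset Printing Implicit Defensive.
Local Open Scope classical_set_scope.
Local Open Scope ring_scope.

(** On the unit square the two largest eigenvalues of half the Laplacian with
    Dirichlet condition are - pi^2 (simple) and - 5 pi^2 / 2, and a point mass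
    can create an eigenvalue strictly between them.  The one produced here is
    lambda = - 2 pi^2.

    A function f with half Laplacian lambda f which is equal to 1 on the boundary
    is an eigenfunction for the jump measure at x0 as soon as f x0 = 1.  Such an
    f is given by a sine series in y: over the odd m,
      f (x, y) = cos (2 pi y) + sum_m b_m sin (m pi y) C_m (x),
    where b_m = - 16 / (pi m (m^2 - 4)) are the sine coefficients of
    1 - cos (2 pi y), C_m'' = (m^2 - 4) pi^2 C_m and C_m (0) = C_m (1) = 1.  Thus
    C_1 is a cosine, and the other C_m are hyperbolic cosines.  The value 1 on
    the horizontal sides is visible on every term.  On the strip 0 < x < 1 the
    terms decay exponentially, so that all derivatives can be taken term by term;
    on the vertical sides they do not.  There the symmetry f (x, y) = f (y, x)
    helps (sol_sym): both sides have the same double sine coefficients, and the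
    sine system is complete (sine_complete).  It gives the value 1 on the
    vertical sides, and it carries the regularity of f near the horizontal sides
    over to the vertical ones (C2_jump_profile).

    The value 1 is attained inside because f - 1 changes sign just above the
    bottom side, where the slope is
      f_y (x, 0) = (16 / 3) C_1 (x) - 16 sum_(m >= 3) C_m (x) / (m^2 - 4).
    At x = 1/2 it is negative since C_1 is (sol_slope_mid).  At x = 0 it
    vanishes, and just to the right of 0 it is positive since there the decrease
    of C_3 alone outweighs that of C_1 (sol_slope_left).  The intermediate value
    theorem on a horizontal segment then gives x0 (jump_profile_attains1).

    As for the Dirichlet spectrum, let u be an eigenfunction for a real lambda
    above - 5 pi^2 / 2, and let F_n (x) be the integral of u (x, y) sin (n pi y)
    over y.  Then F_n'' = (2 lambda + n^2 pi^2) F_n and F_n vanishes at 0 and 1.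
    The constant is too large for a nonzero solution unless n = 1 and
    lambda = - pi^2, and by completeness u is a multiple of
    sin (pi x) sin (pi y) (dirichlet_eigen_real).  Since - 5 pi^2 / 2 is an
    eigenvalue, it is the second one (second_dirichlet_eigenvalue). *)

(** * Dominated series of functions *)

Section SeriesTools.
Context {R : realType}.
Implicit Types u v M : nat -> R.

Definition sumr (u : nat -> R) : R := limn (series u).

Lemma dominated_cvg_series u M : cvgn (series M) -> (forall n, `|u n| <= M n) ->
  cvgn (series u).
Proof.
move=> cM uM; apply: normed_cvg.
apply: (series_le_cvg _ _ _ cM) => // n; first exact: normr_ge0.
by have := le_trans (normr_ge0 _) (uM n).
Qed.

Lemma dominated_series_tail u M N : cvgn (series M) -> (forall n, `|u n| <= M n) ->
  `|sumr u - series u N| <= sumr M - series M N.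
Proof.
move=> cM uM; have cu := dominated_cvg_series cM uM.
have M0 n : 0 <= M n by have := le_trans (normr_ge0 _) (uM n).
have h : (fun n => `|series u n - series u N|) @ \oo --> `|sumr u - series u N|.
  by apply: cvg_norm; apply: cvgB => //; exact: cvg_cst.
rewrite -(cvg_lim _ h)//; apply: limr_le; first by apply/cvg_ex; exists (`|sumr u - series u N|).
near=> n; have nN : (N <= n)%N by near: n; exists N.
rewrite !sub_series_geq//.
apply: (le_trans (ler_norm_sum _ _ _)).
apply: (@le_trans _ _ (series M n - series M N)).
  rewrite sub_series_geq//.
  by apply: ler_sum.
rewrite lerD2r; apply: nondecreasing_cvgn_le => //.
by apply/nondecreasing_seqP => k; rewrite -subr_ge0 seriesSB.
Unshelve. all: by end_near. Qed.

Lemma sumrD (u v : nat -> R) : cvgn (series u) -> cvgn (series v) ->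
  sumr (fun j => u j + v j) = sumr u + sumr v.
Proof. by move=> cu cv; rewrite /sumr -[RHS](lim_seriesD cu cv). Qed.

Lemma sumrZ (k : R) (u : nat -> R) : cvgn (series u) ->
  sumr (fun j => k * u j) = k * sumr u.
Proof. by move=> cu; rewrite /sumr -[RHS](lim_seriesZ k cu). Qed.

Lemma sumrZr (k : R) (u : nat -> R) : cvgn (series u) ->
  sumr (fun j => u j * k) = sumr u * k.
Proof.
by move=> cu; rewrite mulrC -sumrZ//; congr sumr; apply/funext => j; rewrite mulrC.
Qed.

Lemma sumr0 (u : nat -> R) : (forall j, u j = 0) -> sumr u = 0.
Proof.
move=> u0; rewrite /sumr (_ : series u = fun=> 0) ?lim_cst//.
by apply/funext => n; rewrite /series/= big1.
Qed.

Lemma sumr_single (u : nat -> R) i : (forall j, j != i -> u j = 0) -> sumr u = u i.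
Proof.
move=> ui; apply/cvg_lim => //.
apply: cvg_near_cst; exists i.+1 => // m /= im.
by rewrite /series/= (bigD1_seq i)//= ?iota_uniq ?mem_index_iota// big1 ?addr0.
Qed.

Lemma sumr_ge_head (u : nat -> R) : (forall j, 0 <= u j) -> cvgn (series u) -> u 0%N <= sumr u.
Proof.
move=> u0 cu; apply: limr_ge => //.
exists 1%N => // n /= n1; rewrite /series/= -(prednK n1) big_nat_recl//.
by rewrite lerDl sumr_ge0.
Qed.

(** Dominated convergence for series, along any filter: the majorant makes the
    tails uniformly small, and finitely many terms converge one by one.
    Continuity and differentiation term by term both come from it. *)
Lemma tannery {T : Type} (F : set_system T) {FF : ProperFilter F}
    (e : nat -> T -> R) (l M : nat -> R) :
  cvgn (series M) -> (forall n, e n t @[t --> F] --> l n) ->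
  (\forall t \near F, forall n, `|e n t| <= M n) ->
  sumr (fun n => e n t) @[t --> F] --> sumr l.
Proof.
move=> cM el eM.
have lM n : `|l n| <= M n.
  have h : `|e n t| @[t --> F] --> `|l n| by apply: cvg_norm.
  rewrite -(cvg_lim _ h)//; apply: limr_le; first by apply/cvg_ex; exists `|l n|.
  by apply: filterS eM => t; exact.
apply/cvgrPdist_lt => eps eps0.
have e4 : 0 < eps / 3 by rewrite divr_gt0.
have /cvgrPdist_lt/(_ _ e4)[N _ /(_ N (leqnn N))] : series M @ \oo --> sumr M by [].
move=> /ltr_normlW tailM.
have fin : series (fun n => e n t) N @[t --> F] --> series l N.
  elim: N {tailM} => [|N IH].
    under eq_fun do rewrite /series/= big_geq//.
    by rewrite /series/= big_geq//; exact: cvg_cst.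
  rewrite seriesSr.
  under eq_fun do rewrite seriesSr.
  exact: cvgD.
near=> t.
have t1 : `|series l N - series (fun n => e n t) N| < eps / 3.
  by near: t; move/cvgrPdist_lt : fin; exact.
have t2 : forall n, `|e n t| <= M n by near: t.
have t3 := dominated_series_tail N cM lM.
have t4 := dominated_series_tail N cM t2.
have -> : sumr l - sumr (fun n => e n t) = (sumr l - series l N) +
  (series l N - series (fun n => e n t) N) -
  (sumr (fun n => e n t) - series (fun n => e n t) N) by ring.
apply: le_lt_trans (ler_normB _ _) _.
have := ler_normD (sumr l - series l N) (series l N - series (fun n => e n t) N).
lra.
Unshelve. all: by end_near. Qed.

Lemma MVT_bound (g dg : R -> R) (a b K s t : R) :
  s \in `]a, b[ -> t \in `]a, b[ ->
  (forall x, x \in `]a, b[ -> is_derive x 1 g (dg x)) ->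
  (forall x, x \in `]a, b[ -> `|dg x| <= K) ->
  `|g s - g t| <= K * `|s - t|.
Proof.
move=> + + dgE dgK; wlog st : s t / s <= t.
  move=> H sab tab; have [st|/ltW ts] := leP s t; first exact: H.
  by rewrite distrC [in leRHS]distrC; exact: H.
rewrite !in_itv/= => /andP[a1 b1] /andP[a2 b2].
have sub x : x \in `[s, t] -> x \in `]a, b[.
  by rewrite !in_itv/= => /andP[? ?]; apply/andP; split; lra.
have dst x : x \in `]s, t[%R -> is_derive x 1 g (dg x).
  by move=> xst; apply: dgE; apply: sub; exact: subset_itv_oo_cc xst.
have cst : {within `[s, t], continuous g}.
  apply: derivable_within_continuous => x xst.
  by have [] := dgE _ (sub _ xst).
have [x xst e] := MVT_segment st dst cst.
by rewrite distrC e normrM [in leRHS]distrC ler_wpM2r// dgK// sub.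
Qed.

Lemma near_shift_itvoo (a b x : R) : x \in `]a, b[ ->
  \forall h \near (0 : R)^', h + x \in `]a, b[.
Proof.
rewrite in_itv/= => /andP[ax xb].
near=> h.
have h1 : `|h| < x - a by near: h; apply: dnbhs0_lt; rewrite subr_gt0.
have h2 : `|h| < b - x by near: h; apply: dnbhs0_lt; rewrite subr_gt0.
move: h1 h2; rewrite !ltr_norml !in_itv/= => /andP[? ?] /andP[? ?].
by apply/andP; split; lra.
Unshelve. all: by end_near. Qed.

(** Tannery's theorem for the difference quotients, which the mean value
    theorem bounds by the majorant of the derivatives. *)
Lemma is_derive_sumr (e de : nat -> R -> R) (a b x : R) M :
  cvgn (series M) -> x \in `]a, b[ ->
  (forall n t, t \in `]a, b[ -> is_derive t 1 (e n) (de n t)) ->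
  (forall n t, t \in `]a, b[ -> `|de n t| <= M n) ->
  (forall t, t \in `]a, b[ -> cvgn (series (e ^~ t))) ->
  is_derive x 1 (fun t => sumr (e ^~ t)) (sumr (de ^~ x)).
Proof.
move=> cM xab de1 deM ce.
suff : h^-1 *: (sumr (e ^~ (h *: 1 + x)) - sumr (e ^~ x)) @[h --> (0 : R)^'] -->
    sumr (de ^~ x).
  move=> h; apply: DeriveDef; last exact: (cvg_lim _ h).
  by apply/cvg_ex; exists (sumr (de ^~ x)).
have H : (sumr (fun n => h^-1 *: (e n (h *: 1 + x) - e n x))) @[h --> (0 : R)^'] -->
    sumr (de ^~ x).
  apply: (@tannery _ _ _ _ _ M) => //.
    by move=> n; have [D <-] := de1 n x xab; exact: D.
  near=> h => n.
  have hx : h + x \in `]a, b[ by near: h; exact: near_shift_itvoo.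
  have h0 : h != 0 by near: h; exact: nbhs_dnbhs_neq.
  rewrite normrM normfV scaler1 ler_pdivrMl ?normr_gt0//.
  by have := MVT_bound hx xab (de1 n) (deM n); rewrite addrK mulrC.
apply: cvg_trans H; apply: near_eq_cvg; near=> h.
have hx : h + x \in `]a, b[ by near: h; exact: near_shift_itvoo.
rewrite scaler1 /sumr -lim_seriesB; [|exact: ce|exact: ce].
rewrite -lim_seriesZ; last by apply: is_cvg_seriesB; exact: ce.
by [].
Unshelve. all: by end_near. Qed.
End SeriesTools.

(** * Continuous functions on the unit interval and their integrals *)

Section Integral.
Context {R : realType}.
Notation mu := (@lebesgue_measure R).
Implicit Types f g : R -> R.

Lemma within_continuous_sumr {T : topologicalType} (A : set T)
    (e : nat -> T -> R) M :
  cvgn (series M) -> (forall n, {within A, continuous (e n)}) ->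
  (forall n t, A t -> `|e n t| <= M n) ->
  {within A, continuous (fun t => sumr (e ^~ t))}.
Proof.
move=> cM ce eM; rewrite continuous_subspace_in => x /set_mem Ax.
apply: (@tannery _ _ _ _ e _ M) => //.
  by move=> n; exact: ce.
suff : within A (nbhs x) [set t | forall n, `|e n t| <= M n].
  by rewrite nbhs_subspace_in.
by rewrite /within/=; near=> t => At n; exact: eM.
Unshelve. all: by end_near. Qed.

Definition C01 g := {within `[0, 1], continuous g}.
Definition I01 g : R := \int[mu]_(x in `[0, 1]) g x.

Lemma C01_continuous g : continuous g -> C01 g.
Proof. exact: continuous_subspaceT. Qed.

Lemma C01D f g : C01 f -> C01 g -> C01 (fun x => f x + g x).
Proof. by move=> cf cg x; apply: continuousD; [exact: cf|exact: cg]. Qed.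

Lemma C01M f g : C01 f -> C01 g -> C01 (fun x => f x * g x).
Proof. by move=> cf cg x; apply: continuousM; [exact: cf|exact: cg]. Qed.

Lemma C01N f : C01 f -> C01 (fun x => - f x).
Proof. by move=> cf x; apply: continuousN; exact: cf. Qed.

Lemma C01_cst (k : R) : C01 (fun=> k).
Proof. by apply: C01_continuous => x; exact: cvg_cst. Qed.

Lemma C01_integrable f : C01 f -> mu.-integrable `[0, 1] (EFin \o f).
Proof. by move=> ?; apply: continuous_compact_integrable => //; exact: segment_compact. Qed.

Lemma eq_I01 f g : (forall x : R, x \in `[0, 1] -> f x = g x) -> I01 f = I01 g.
Proof. by move=> fg; apply: eq_Rintegral => x /set_mem/= x01; exact: fg. Qed.

Lemma I01D f g : C01 f -> C01 g -> I01 (fun x => f x + g x) = I01 f + I01 g.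
Proof. by move=> cf cg; apply: RintegralD => //; exact: C01_integrable. Qed.

Lemma I01Z (k : R) f : C01 f -> I01 (fun x => k * f x) = k * I01 f.
Proof. by move=> cf; apply: RintegralZl => //; exact: C01_integrable. Qed.

Lemma I01N f : C01 f -> I01 (fun x => - f x) = - I01 f.
Proof.
by move=> cf; under [LHS]eq_I01 do rewrite -mulN1r; rewrite I01Z// mulN1r.
Qed.

Lemma I01B f g : C01 f -> C01 g -> I01 (fun x => f x - g x) = I01 f - I01 g.
Proof. by move=> cf cg; rewrite I01D ?I01N//; exact: C01N. Qed.

Lemma I01_cst (k : R) : I01 (fun=> k) = k.
Proof.
by rewrite /I01 Rintegral_cst//= lebesgue_measure_itv/= lte_fin ltr01 sube0 mulr1.
Qed.

Lemma le_I01 f g : C01 f -> C01 g -> (forall x : R, x \in `[0, 1] -> f x <= g x) ->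
  I01 f <= I01 g.
Proof. by move=> cf cg fg; apply: le_Rintegral => //; exact: C01_integrable. Qed.

Lemma normr_I01 f (K : R) : C01 f -> (forall x : R, x \in `[0, 1] -> `|f x| <= K) ->
  `|I01 f| <= K.
Proof.
move=> cf fK; rewrite ler_norml; apply/andP; split.
  rewrite -[- K]I01_cst; apply: le_I01 => //; first exact: C01_cst.
  by move=> x /fK; rewrite ler_norml => /andP[].
rewrite -[K]I01_cst; apply: le_I01 => //; first exact: C01_cst.
by move=> x /fK; rewrite ler_norml => /andP[].
Qed.

Lemma I01_FTC F f : C01 F -> C01 f ->
  (forall x : R, x \in `]0, 1[ -> is_derive x 1 F (f x)) -> I01 f = F 1 - F 0.
Proof.
move=> cF cf dF; rewrite /I01 /Rintegral.
rewrite (@continuous_FTC2 _ f F 0 1)//.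
  have [_ ? ?] := (continuous_within_itvP F (@ltr01 R)).1 cF; split => // x x01.
  by have [] := dF x x01.
by move=> x x01; rewrite derive1E; have [_ ->] := dF x x01.
Qed.

(** The window stays away from 0 and 1, so that it can be used for integrals
    and for the monotonicity of cosine alike. *)
Lemma C01_near_ge_half f (x0 : R) : C01 f -> x0 \in `]0, 1[ -> 0 < f x0 ->
  exists r, [/\ 0 < r, 0 < x0 - r, x0 + r < 1 &
    forall x : R, x \in `[x0 - r, x0 + r] -> f x0 / 2 <= f x].
Proof.
move=> cf x01 fx0.
have c0 : f x @[x --> x0] --> f x0.
  by have [+ _ _] := (continuous_within_itvP f (@ltr01 R)).1 cf; exact.
move: (c0) => /cvgrPdist_lt/(_ (f x0 / 2)); rewrite divr_gt0// => /(_ isT).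
move=> /nbhs_ballP[d /= d0 dP].
move: x01; rewrite in_itv/= => /andP[x00 x01].
pose r := Num.min (d / 2) (Num.min (x0 / 2) ((1 - x0) / 2)).
have r0 : 0 < r by rewrite !lt_min !divr_gt0// subr_gt0.
have : r <= r by [].
rewrite {2}/r !le_min => /and3P[r1 r2 r3].
exists r; split => //; [lra|lra|].
move=> x; rewrite in_itv/= => /andP[? ?].
have : `|f x0 - f x| < f x0 / 2.
  by apply: dP; rewrite /ball/= ltr_norml; apply/andP; split; lra.
by move=> /ltr_normlW; lra.
Qed.

Lemma C01_bounded f : C01 f ->
  exists K, 0 <= K /\ forall x : R, x \in `[0, 1] -> `|f x| <= K.
Proof.
move=> cf.
have /compact_bounded[M [_ mrt]] := continuous_compact cf (@segment_compact R 0 1).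
exists (`|M| + 1); split => [|x x01]; first by rewrite addr_ge0.
by apply: mrt; [rewrite (le_lt_trans (ler_norm M))// ltrDl|exists x].
Qed.

Lemma I01_gt0 f (x0 : R) : C01 f -> (forall x : R, x \in `[0, 1] -> 0 <= f x) ->
  x0 \in `]0, 1[ -> 0 < f x0 -> 0 < I01 f.
Proof.
move=> cf f0 x01 fx0.
have [r [r0 r1 r2 fr]] := C01_near_ge_half cf x01 fx0.
pose a := x0 - r; pose b := x0 + r.
have ab : a < b by rewrite /a /b; lra.
have sub : `[a, b] `<=` `[0, 1].
  by move=> x; rewrite /= !in_itv/= /a /b => /andP[? ?]; apply/andP; split; lra.
pose g := (fun=> f x0 / 2) \_ (`[a, b]).
have ig : mu.-integrable `[0, 1] (EFin \o g).
  rewrite /g -restrict_EFin; apply/integrable_restrict => //.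
  rewrite setIidr//.
  apply: continuous_compact_integrable; first exact: segment_compact.
  by apply: continuous_subspaceT => x; exact: cvg_cst.
apply: (@lt_le_trans _ _ (\int[mu]_(x in `[0, 1]) g x)).
  rewrite -Rintegral_mkcondr setIidr// Rintegral_cst//= lebesgue_measure_itv/=.
  by rewrite lte_fin ab/= mulr_gt0 ?divr_gt0// subr_gt0.
apply: le_Rintegral => //; first exact: C01_integrable.
move=> x x01'; rewrite /g patchE; case: ifPn => [/set_mem/=|_]; first exact: fr.
exact: f0.
Qed.

Lemma C01_eq0 g : C01 g -> (forall x : R, x \in `]0, 1[ -> g x = 0) ->
  forall x : R, x \in `[0, 1] -> g x = 0.
Proof.
move=> cg goo.
have [_ gl gr] := (continuous_within_itvP g (@ltr01 R)).1 cg.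
move=> x; rewrite in_itv/= => /andP[]; rewrite le_eqVlt => /predU1P[<- _|x0].
  have : g x @[x --> 0^'+] --> (0 : R).
    apply: cvg_near_cst.
    have h0 := @nbhs_right_gt R 0; have h1 := nbhs_right_lt (@ltr01 R).
    by apply: filterS2 h0 h1 => y y0 y1; apply: goo; rewrite in_itv/= y0.
  exact: cvg_unique.
rewrite le_eqVlt => /predU1P[->|x1]; last by apply: goo; rewrite in_itv/= x0.
have : g x @[x --> 1^'-] --> (0 : R).
  apply: cvg_near_cst.
  have h0 := @nbhs_left_lt R 1; have h1 := nbhs_left_gt (@ltr01 R).
  by apply: filterS2 h0 h1 => y y0 y1; apply: goo; rewrite in_itv/= y0 y1.
exact: cvg_unique.
Qed.

(** The remainder of the series is uniformly small, hence so is its integral. *)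
Lemma I01_sumr (e : nat -> R -> R) M : cvgn (series M) ->
  (forall n, C01 (e n)) -> (forall n (x : R), x \in `[0, 1] -> `|e n x| <= M n) ->
  I01 (fun x => sumr (e ^~ x)) = sumr (fun n => I01 (e n)).
Proof.
move=> cM ce eM.
have cS : C01 (fun x => sumr (e ^~ x)) by exact: within_continuous_sumr cM ce eM.
have cN N : C01 (fun x => series (e ^~ x) N).
  elim: N => [|N IH].
    under eq_fun do rewrite /series/= big_geq//; exact: C01_cst.
  by under eq_fun do rewrite seriesSr; exact: C01D.
have IN N : I01 (fun x => series (e ^~ x) N) = series (fun n => I01 (e n)) N.
  elim: N => [|N IH].
    rewrite [RHS]/series/= big_geq//.
    by under eq_fun do rewrite /series/= big_geq//; rewrite I01_cst.
  under eq_fun do rewrite seriesSr.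
  by rewrite I01D// IH seriesSr.
apply/esym/cvg_lim => //.
apply/cvgrPdist_le => eps eps0.
have /cvgrPdist_le/(_ _ eps0)[N _ HN] : series M @ \oo --> sumr M by [].
exists N => // n /HN /ler_normlW hn.
rewrite -IN -I01B//.
apply: normr_I01; first by apply: C01D => //; exact: C01N.
by move=> x x01; apply: le_trans hn; apply: dominated_series_tail => // k; exact: eM.
Qed.

End Integral.

(** * Completeness of the sine system *)

Section SineComplete.
Context {R : realType}.
Implicit Types f g : R -> R.

Lemma continuous_sinM (k : R) : continuous (fun x => sin (k * x)).
Proof.
move=> x; apply: (@continuous_comp _ _ _ ( *%R k) sin); first exact: mulrl_continuous.
exact: continuous_sin.
Qed.

Lemma continuous_cosM (k : R) : continuous (fun x => cos (k * x)).
Proof.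
move=> x; apply: (@continuous_comp _ _ _ ( *%R k) cos); first exact: mulrl_continuous.
exact: continuous_cos.
Qed.

Lemma C01_sinM k : C01 (fun x : R => sin (k * x)).
Proof. by apply: C01_continuous; exact: continuous_sinM. Qed.

Lemma C01_cosM k : C01 (fun x : R => cos (k * x)).
Proof. by apply: C01_continuous; exact: continuous_cosM. Qed.

Lemma C01X f n : C01 f -> C01 (fun x : R => f x ^+ n).
Proof.
move=> cf; elim: n => [|n IH]; first by under eq_fun do rewrite expr0; exact: C01_cst.
by under eq_fun do rewrite exprS; exact: C01M.
Qed.

Lemma bernoulli_ge (t : R) n : 0 <= t -> 1 + n%:R * (t - 1) <= t ^+ n.
Proof.
move=> t0; elim: n => [|n IH]; first by rewrite expr0 mul0r addr0.
rewrite exprS; apply: le_trans (ler_wpM2l t0 IH).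
rewrite -subr_ge0 -natr1.
have -> : t * (1 + n%:R * (t - 1)) - (1 + (n%:R + 1) * (t - 1)) =
  n%:R * (t - 1) ^+ 2 by ring.
by rewrite mulr_ge0// sqr_ge0.
Qed.

(** Multiplying by cos (pi x) turns a sine into the mean of its two
    neighbours, so orthogonality to all sines passes to their products with
    the powers of cos (pi x). *)
Lemma sine_moments_cos g : C01 g ->
  (forall n, I01 (fun x => g x * sin (n.+1%:R * pi * x)) = 0) ->
  forall k n, I01 (fun x => g x * sin (n%:R * pi * x) * cos (pi * x) ^+ k) = 0.
Proof.
move=> cg g0.
have c1 k n : C01 (fun x => g x * sin (n%:R * pi * x) * cos (pi * x) ^+ k).
  by apply: C01M; [apply: C01M => //; exact: C01_sinM|apply: C01X; exact: C01_cosM].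
elim=> [|k IH] [|n].
- rewrite (@eq_I01 _ _ (fun=> 0)) ?I01_cst// => x _.
  by rewrite !mul0r sin0 mulr0 mul0r.
- by rewrite -[RHS](g0 n); apply: eq_I01 => x _; rewrite expr0 mulr1.
- rewrite (@eq_I01 _ _ (fun=> 0)) ?I01_cst// => x _.
  by rewrite !mul0r sin0 mulr0 mul0r.
- rewrite (@eq_I01 _ _ (fun x => 2^-1 * (g x * sin (n.+2%:R * pi * x) * cos (pi * x) ^+ k) +
    2^-1 * (g x * sin (n%:R * pi * x) * cos (pi * x) ^+ k))).
    rewrite I01D ?I01Z// ?IH ?mulr0 ?addr0//.
      by apply: C01M; [exact: C01_cst|exact: c1].
    by apply: C01M; [exact: C01_cst|exact: c1].
  move=> x _.
  have -> : n.+2%:R * pi * x = n.+1%:R * pi * x + pi * x.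
    by rewrite -[n.+2%:R]natr1; ring.
  have -> : n%:R * pi * x = n.+1%:R * pi * x - pi * x.
    by rewrite -[n.+1%:R]natr1; ring.
  by rewrite sinD sinB exprS; field.
Qed.

(** The last factor is a polynomial in cos (pi x); induction on its power, all
    powers of the cosine being treated at once. *)
Lemma sine_moments_peak g : C01 g ->
  (forall n, I01 (fun x => g x * sin (n.+1%:R * pi * x)) = 0) ->
  forall (a c : R) N k,
  I01 (fun x => g x * sin (pi * x) * cos (pi * x) ^+ k *
    (a - (cos (pi * x) - c) ^+ 2 / 4) ^+ N) = 0.
Proof.
move=> cg g0 a c.
have c1 N k : C01 (fun x => g x * sin (pi * x) * cos (pi * x) ^+ k *
    (a - (cos (pi * x) - c) ^+ 2 / 4) ^+ N).
  apply: C01M; first apply: C01M.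
  - by apply: C01M => //; exact: C01_sinM.
  - by apply: C01X; exact: C01_cosM.
  - apply: C01X; apply: C01D; first exact: C01_cst.
    apply: C01N; apply: C01M; last exact: C01_cst.
    by apply: C01X; apply: C01D; [exact: C01_cosM|exact: C01_cst].
have c2 (b : R) N k : C01 (fun x => b * (g x * sin (pi * x) * cos (pi * x) ^+ k *
    (a - (cos (pi * x) - c) ^+ 2 / 4) ^+ N)).
  by apply: C01M; [exact: C01_cst|exact: c1].
elim=> [|N IH] k.
  rewrite -[RHS](sine_moments_cos cg g0 k 1); apply: eq_I01 => x _.
  by rewrite expr0 mul1r mulr1.
rewrite (@eq_I01 _ _ (fun x => (a - c ^+ 2 / 4) * (g x * sin (pi * x) * cos (pi * x) ^+ k *
    (a - (cos (pi * x) - c) ^+ 2 / 4) ^+ N) + c / 2 * (g x * sin (pi * x) * cos (pi * x) ^+ k.+1 *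
    (a - (cos (pi * x) - c) ^+ 2 / 4) ^+ N) + (- 4^-1) * (g x * sin (pi * x) * cos (pi * x) ^+ k.+2 *
    (a - (cos (pi * x) - c) ^+ 2 / 4) ^+ N))).
  by rewrite I01D ?I01D ?I01Z ?IH ?mulr0 ?addr0//; exact: C01D.
by move=> x _; rewrite [_ ^+ N.+1]exprS !exprS; field.
Qed.

(** If g were positive at x0, the polynomial T = 1 + rho - (cos (pi x) - cos
    (pi x0))^2 / 4 in cos (pi x) would exceed 1 near x0 and stay between 0 and
    1 away from it. The integrals of g (x) sin (pi x) T^N, which are all zero,
    would then grow at least linearly in N. *)
Lemma sine_complete_le0 g : C01 g ->
  (forall n, I01 (fun x => g x * sin (n.+1%:R * pi * x)) = 0) ->
  forall x : R, x \in `]0, 1[ -> g x <= 0.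
Proof.
move=> cg g0 x0 x01; rewrite leNgt; apply/negP => gx0.
pose h x := g x * sin (pi * x).
have p0 := pi_gt0 R.
have ch : C01 h by apply: C01M => //; exact: C01_sinM.
have hx0 : 0 < h x0.
  move: x01; rewrite in_itv/= => /andP[? ?].
  rewrite mulr_gt0// sin_gt0_pi// mulr_gt0//=.
  by rewrite -[ltRHS]mulr1 ltr_pM2l.
have [r [r0 rl rr hr]] := C01_near_ge_half ch x01 hx0.
have [K [K0 hK]] := C01_bounded ch.
pose c := cos (pi * x0).
pose D x := (cos (pi * x) - c) ^+ 2 / 4.
have cmono (x y : R) : 0 <= x -> x < y -> y <= 1 -> cos (pi * y) < cos (pi * x).
  move=> x_0 xy y_1; rewrite ltr_cos ?ltr_pM2l// in_itv/=.
    by rewrite mulr_ge0//= ?(ltW p0)// ger_pMr//; lra.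
  by rewrite mulr_ge0//= ?(ltW p0)// ?ger_pMr//; lra.
(* By monotonicity of the cosine, D is smallest outside the window at its ends. *)
pose rho := Num.min (D (x0 - r)) (D (x0 + r)) / 2.
have cl : c < cos (pi * (x0 - r)) by apply: cmono; lra.
have cr : cos (pi * (x0 + r)) < c by apply: cmono; lra.
have rho0 : 0 < rho.
  rewrite divr_gt0// lt_min; apply/andP; split.
    by rewrite divr_gt0// exprn_gt0// subr_gt0.
  by rewrite divr_gt0// -sqrrN opprB exprn_gt0// subr_gt0.
have : rho * 2 <= Num.min (D (x0 - r)) (D (x0 + r)) by rewrite divfK.
rewrite le_min => /andP[rhol rhor].
have Dout x : x \in `[0, 1] -> x \notin `[x0 - r, x0 + r] -> rho * 2 <= D x.
  rewrite !in_itv/= => /andP[x_0 x_1]; rewrite negb_and -!ltNge => /orP[xl|xr].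
    have h1 : cos (pi * (x0 - r)) < cos (pi * x) by apply: cmono; lra.
    apply: (le_trans rhol); rewrite ler_pM2r//; rewrite -subr_ge0.
    rewrite subr_sqr mulr_ge0//; lra.
  have h1 : cos (pi * x) < cos (pi * (x0 + r)) by apply: cmono; lra.
  apply: (le_trans rhor); rewrite ler_pM2r//; rewrite -subr_ge0.
  rewrite subr_sqr mulr_le0//; lra.
have D1 x : D x <= 1.
  rewrite ler_pdivrMr// mul1r.
  have := cos_le1 (pi * x); have := cos_geN1 (pi * x).
  have := cos_le1 (pi * x0); have := cos_geN1 (pi * x0); rewrite -/c.
  set s := cos _ => *; rewrite -subr_ge0.
  have -> : 4 - (s - c) ^+ 2 = (2 - (s - c)) * (2 + (s - c)) by ring.
  by rewrite mulr_ge0//; lra.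
have D0 x : 0 <= D x by rewrite divr_ge0// sqr_ge0.
(* Lower bound of T^N / N inside the window, by Bernoulli; zero outside. *)
pose psi x := Num.max 0 (rho - D x).
have cD : C01 D.
  apply: C01M; last exact: C01_cst.
  by apply: C01X; apply: C01D; [exact: C01_cosM|exact: C01_cst].
have cpsi : C01 psi.
  have cE : C01 (fun x => rho - D x) by apply: C01D; [exact: C01_cst|exact: C01N].
  rewrite /psi; under eq_fun do rewrite maxr_absE add0r sub0r normrN.
  apply: C01M; last exact: C01_cst.
  by apply: C01D => // x; apply: cvg_norm; exact: cE.
have psi0 x : 0 <= psi x by rewrite le_max lexx.
have Ipsi : 0 < I01 psi.
  apply: (@I01_gt0 _ _ x0) => // .
  by rewrite /psi /D subrr expr0n mul0r subr0 lt_max rho0 orbT.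
pose eta := h x0 / 2.
have eta0 : 0 < eta by rewrite divr_gt0.
have key N : - K + N%:R * eta * I01 psi <= 0.
  have := sine_moments_peak cg g0 (1 + rho) c N 0 => E.
  rewrite -{}E.
  have -> : - K + N%:R * eta * I01 psi = I01 (fun x => - K + N%:R * eta * psi x).
    rewrite I01D ?I01_cst ?I01Z//; first exact: C01_cst.
    by apply: C01M => //; exact: C01_cst.
  apply: le_I01.
    by apply: C01D; [exact: C01_cst|apply: C01M => //; exact: C01_cst].
    apply: C01M; first by apply: C01M => //; apply: C01X; exact: C01_cosM.
    by apply: C01X; apply: C01D; [exact: C01_cst|exact: C01N].
  move=> x x01'; rewrite expr0 mulr1 -/(h x) -/(D x).
  have T0 : 0 <= 1 + rho - D x by have := D1 x; lra.
  have [xr|xr] := boolP (x \in `[x0 - r, x0 + r]).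
    have hx := hr _ xr.
    apply: (@le_trans _ _ (eta * (1 + rho - D x) ^+ N)); last first.
      by rewrite ler_wpM2r// exprn_ge0.
    apply: (@le_trans _ _ (N%:R * eta * psi x)); first by rewrite gerDr oppr_le0.
    rewrite -mulrA mulrCA ler_pM2l// /psi maxr_pMr// mulr0 ge_max exprn_ge0//=.
    apply: le_trans (bernoulli_ge N T0).
    by rewrite -subr_ge0 [X in 0 <= X](_ : _ = 1)//; ring.
  have Dx := Dout _ x01' xr.
  have -> : psi x = 0 by apply/max_idPl; lra.
  rewrite mulr0 addr0.
  suff : `|h x * (1 + rho - D x) ^+ N| <= K by rewrite ler_norml => /andP[].
  rewrite normrM -[K]mulr1 ler_pM//; first exact: hK.
  rewrite normrX ger0_norm// exprn_ile1//; lra.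
have [N] : exists N : nat, K / (eta * I01 psi) < N%:R.
  by exists (Num.bound (K / (eta * I01 psi))); apply: archi_boundP; rewrite divr_ge0// ltW// mulr_gt0.
have e0 : 0 < eta * I01 psi by rewrite mulr_gt0.
rewrite (ltr_pdivrMr _ _ e0).
have := key N; lra.
Qed.

Lemma sine_complete g : C01 g ->
  (forall n, I01 (fun x => g x * sin (n.+1%:R * pi * x)) = 0) ->
  forall x : R, x \in `[0, 1] -> g x = 0.
Proof.
move=> cg g0.
have goo (x : R) : x \in `]0, 1[ -> g x = 0.
  move=> x01; apply/eqP; rewrite eq_le (sine_complete_le0 cg)//=.
  rewrite -oppr_le0; apply: (sine_complete_le0 (C01N cg)) => // n.
  under eq_fun do rewrite mulNr.
  by rewrite I01N ?g0 ?oppr0//; apply: C01M => //; exact: C01_sinM.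
exact: C01_eq0.
Qed.

End SineComplete.

(** * Functions on the closed square *)

Section Plane.
Context {R : realType}.
Implicit Types (u v : R * R -> R) (x y : R).

Lemma within_continuous_comp_sub {T U V : topologicalType} (A : set T) (B : set U)
    (phi : T -> U) (h : U -> V) :
  (forall t, A t -> B (phi t)) -> {within A, continuous phi} ->
  {within B, continuous h} -> {within A, continuous (h \o phi)}.
Proof.
move=> AB /subspace_continuousP cphi /subspace_continuousP ch.
apply/subspace_continuousP => t At.
apply: cvg_trans (ch _ (AB _ At)) => W /= hW.
have := cphi t At _ hW; rewrite /within /nbhs /= /within /=.
by apply: filterS => s + As; apply => //; exact: AB.
Qed.

Lemma squareE (z : R * R) :
  square z <-> (0 < z.1 < 1) /\ (0 < z.2 < 1).
Proof. by rewrite /square /= !in_itv. Qed.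

Lemma square_closureE : closure (@square R) = `[0, 1] `*` `[0, 1].
Proof.
rewrite eqEsubset; split => [|[x y]].
  move=> z; rewrite closureE; apply; split; last first.
    by move=> w [] /=; rewrite !in_itv/= => /andP[/ltW-> /ltW->] /andP[/ltW-> /ltW->].
  rewrite (_ : _ `*` _ = fst @^-1` `[0, 1] `&` snd @^-1` `[0, 1])//.
  apply: closedI; apply: closed_comp; try exact: itv_closed.
    by move=> w _; exact: cvg_fst.
  by move=> w _; exact: cvg_snd.
rewrite /= !in_itv/= => -[/andP[x0 x1] /andP[y0 y1]] B /nbhs_ballP[e /= e0 eB].
(* Points of the closed square are pushed towards its centre. *)
pose t := Num.min (e / 2) (1 / 2).
have t0 : 0 < t by rewrite lt_min !divr_gt0.
have : t <= t by [].
rewrite {2}/t le_min => /andP[t1 t2].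
exists (x + t * (1 / 2 - x), y + t * (1 / 2 - y)); split.
  by apply/squareE => /=; split; apply/andP; split; nra.
by apply: eB; rewrite /ball/= /prod_ball/=; split; rewrite /ball/= ltr_norml;
  apply/andP; split; nra.
Qed.

Lemma closure_squareP (z : R * R) :
  closure (@square R) z <-> (0 <= z.1 <= 1) /\ (0 <= z.2 <= 1).
Proof. by rewrite square_closureE /= !in_itv. Qed.

Lemma open_square : open (@square R).
Proof.
rewrite (_ : square = fst @^-1` `]0, 1[ `&` snd @^-1` `]0, 1[)//.
apply: openI; apply: open_comp; try exact: interval_open.
  by move=> z _; exact: cvg_fst.
by move=> z _; exact: cvg_snd.
Qed.

Lemma near_square z : square z -> \forall w \near z, @square R w.
Proof. by move=> sz; apply: open_nbhs_nbhs; split => //; exact: open_square. Qed.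

Lemma is_derive_axis0 u x y (l : R) :
  is_derive (x, y) (axis ord0) u l <-> is_derive x 1 (fun t => u (t, y)) l.
Proof.
have E : (fun h : R => h^-1 *: ((u \o shift (x, y)) (h *: axis ord0) - u (x, y))) =
  (fun h => h^-1 *: (((fun t => u (t, y)) \o shift x) (h *: 1) - u (x, y))).
  apply/funext => h; rewrite /= /axis/=.
  by congr (_ *: (u _ - _)); congr pair; rewrite /= scaler0 add0r.
have D : derivable u (x, y) (axis ord0) = derivable (fun t => u (t, y)) x 1.
  exact: (congr1 (fun q : R -> R => cvg (q @ (0 : R)^')) E).
have D' : derive u (x, y) (axis ord0) = derive (fun t => u (t, y)) x 1.
  exact: (congr1 (fun q : R -> R => lim (q @ (0 : R)^')) E).
by split=> -[d1 d2]; apply: DeriveDef; [rewrite -D|rewrite -D'|rewrite D|rewrite D'].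
Qed.

Lemma is_derive_axis1 u x y (l : R) :
  is_derive (x, y) (axis ord_max) u l <-> is_derive y 1 (fun t => u (x, t)) l.
Proof.
have E : (fun h : R => h^-1 *: ((u \o shift (x, y)) (h *: axis ord_max) - u (x, y))) =
  (fun h => h^-1 *: (((fun t => u (x, t)) \o shift y) (h *: 1) - u (x, y))).
  apply/funext => h; rewrite /= /axis/=.
  by congr (_ *: (u _ - _)); congr pair; rewrite /= scaler0 add0r.
have D : derivable u (x, y) (axis ord_max) = derivable (fun t => u (x, t)) y 1.
  exact: (congr1 (fun q : R -> R => cvg (q @ (0 : R)^')) E).
have D' : derive u (x, y) (axis ord_max) = derive (fun t => u (x, t)) y 1.
  exact: (congr1 (fun q : R -> R => lim (q @ (0 : R)^')) E).
by split=> -[d1 d2]; apply: DeriveDef; [rewrite -D|rewrite -D'|rewrite D|rewrite D'].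
Qed.

Lemma laplacianE u z : laplacian u z =
  partial ord0 (partial ord0 u) z + partial ord_max (partial ord_max u) z.
Proof.
rewrite /laplacian big_ord_recl big_ord1.
by have -> : lift ord0 ord0 = ord_max :> 'I_2 by apply: val_inj.
Qed.

Definition punctured : set (R * R) := closure square `\` square_corners.

(** Candidates for the derivatives are enough: a partial derivative of u
    agrees with its candidate near each interior point, hence has the same
    derivatives there. *)
Lemma C2_closureI u (U : 'I_2 -> R * R -> R) (V : 'I_2 -> 'I_2 -> R * R -> R) :
  {within closure square, continuous u} ->
  (forall i z, square z -> is_derive z (axis i) u (U i z)) ->
  (forall i, {within punctured, continuous (U i)}) ->
  (forall i j z, square z -> is_derive z (axis j) (U i) (V i j z)) ->
  (forall i j, {within punctured, continuous (V i j)}) ->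
  C2_closure u /\
  (forall z, square z -> laplacian u z = V ord0 ord0 z + V ord_max ord_max z).
Proof.
move=> cu dU cU dV cV.
have pU i z : square z -> partial i u z = U i z.
  by move=> sz; rewrite /partial; have [_ ->] := dU i z sz.
have dpU i j z : square z -> is_derive z (axis j) (partial i u) (V i j z).
  move=> sz; apply: (@near_eq_is_derive _ _ _ (U i)); last exact: dV.
  by apply: filterS (near_square sz) => w sw; rewrite pU.
have pV i j z : square z -> partial j (partial i u) z = V i j z.
  by move=> sz; rewrite {1}/partial; have [_ ->] := dpU i j z sz.
split; last by move=> z sz; rewrite laplacianE !pV.
split => //.
  move=> i; split; first by move=> z /(dU i)[].
  by exists (U i) => // z /set_mem; exact: pU.
move=> i j; split; first by move=> z /(dpU i j)[].
by exists (V i j) => // z /set_mem; exact: pV.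
Qed.

(** The converse: the extensions are at once the derivatives inside and
    continuous up to the sides. *)
Lemma C2_closureE u : C2_closure u -> exists (U : 'I_2 -> R * R -> R)
    (V : 'I_2 -> 'I_2 -> R * R -> R),
  [/\ {within closure square, continuous u},
  (forall i z, square z -> is_derive z (axis i) u (U i z)),
  (forall i, {within punctured, continuous (U i)}),
  (forall i j z, square z -> is_derive z (axis j) (U i) (V i j z)) &
  (forall i j, {within punctured, continuous (V i j)}) /\
  (forall z, square z -> laplacian u z = V ord0 ord0 z + V ord_max ord_max z)].
Proof.
move=> [cu H1 H2].
have /choice[U HU] : forall i : 'I_2, exists h, {within punctured, continuous h} /\
    {in square, partial i u =1 h}.
  by move=> i; have [_ [h ? ?]] := H1 i; exists h; split.
have /choice[V HV] : forall i : 'I_2, exists Vi : 'I_2 -> R * R -> R, forall j,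
    {within punctured, continuous (Vi j)} /\
    {in square, partial j (partial i u) =1 Vi j}.
  move=> i; have /choice[Vi HVi] : forall j : 'I_2, exists h,
    {within punctured, continuous h} /\ {in square, partial j (partial i u) =1 h}.
    by move=> j; have [_ [h ? ?]] := H2 i j; exists h; split.
  by exists Vi.
have pU i z : square z -> partial i u z = U i z.
  by move=> sz; have [_ ->//] := HU i; rewrite inE.
have pV i j z : square z -> partial j (partial i u) z = V i j z.
  by move=> sz; have [_ ->//] := HV i j; rewrite inE.
exists U, V; split => //.
- move=> i z sz; apply: DeriveDef; last by rewrite -pU.
  by have [+ _] := H1 i; exact.
- by move=> i; have [] := HU i.
- move=> i j z sz; apply: (@near_eq_is_derive _ _ _ (partial i u)).
    by apply: filterS (near_square sz) => w sw; rewrite pU.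
  apply: DeriveDef; last by rewrite -pV.
  by have [+ _] := H2 i j; exact.
- split; first by move=> i j; have [] := HV i j.
  by move=> z sz; rewrite laplacianE -!pV.
Qed.

End Plane.

(** * Derivatives, and Green's formula against a sine *)

Section Derive1.
Context {R : realType}.
Implicit Types f g : R -> R.

(** The rules below are stated pointwise: the derivative of an explicit
    expression is assembled by application, and its formula is simplified
    afterwards. *)
Lemma is_derive_mul f g (x df dg : R) : is_derive x 1 f df -> is_derive x 1 g dg ->
  is_derive x 1 (fun t => f t * g t) (df * g x + f x * dg).
Proof.
move=> hf hg; apply: (is_derive_eq (is_deriveM hf hg)).
by rewrite /GRing.scale/= addrC mulrC [X in X + _]mulrC; ring.
Qed.

Lemma is_derive_add f g (x df dg : R) : is_derive x 1 f df -> is_derive x 1 g dg ->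
  is_derive x 1 (fun t => f t + g t) (df + dg).
Proof. by move=> hf hg; exact: is_deriveD. Qed.

Lemma is_derive_opp f (x df : R) : is_derive x 1 f df ->
  is_derive x 1 (fun t => - f t) (- df).
Proof. by move=> hf; exact: is_deriveN. Qed.

Lemma is_derive_lin (a x : R) : is_derive x 1 (fun t => a * t) a.
Proof.
apply: (is_derive_eq (is_derive_mul (is_derive_cst a x 1) (is_derive_id x 1))).
by rewrite mul0r mulr1 add0r.
Qed.

Lemma is_derive_scale (a : R) f (x df : R) : is_derive x 1 f df ->
  is_derive x 1 (fun t => a * f t) (a * df).
Proof.
move=> hf; apply: (is_derive_eq (is_derive_mul (is_derive_cst a x 1) hf)).
by rewrite mul0r add0r.
Qed.

Lemma is_derive_sin_comp f (x df : R) : is_derive x 1 f df ->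
  is_derive x 1 (fun t => sin (f t)) (df * cos (f x)).
Proof.
move=> hf; apply: (is_derive_eq (is_derive1_comp (is_derive_sin _) hf)).
by rewrite /GRing.scale/=; ring.
Qed.

Lemma is_derive_cos_comp f (x df : R) : is_derive x 1 f df ->
  is_derive x 1 (fun t => cos (f t)) (- (df * sin (f x))).
Proof.
move=> hf; apply: (is_derive_eq (is_derive1_comp (is_derive_cos _) hf)).
by rewrite /GRing.scale/=; ring.
Qed.

Lemma is_derive_exp_comp f (x df : R) : is_derive x 1 f df ->
  is_derive x 1 (fun t => expR (f t)) (df * expR (f x)).
Proof.
move=> hf; apply: (is_derive_eq (is_derive1_comp (is_derive_expR _) hf)).
by rewrite /GRing.scale/=; ring.
Qed.

Lemma is_derive_sinM (b x : R) : is_derive x 1 (fun t => sin (b * t)) (b * cos (b * x)).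
Proof. exact: (is_derive_sin_comp (is_derive_lin b x)). Qed.

Lemma is_derive_cosM (b x : R) : is_derive x 1 (fun t => cos (b * t)) (- (b * sin (b * x))).
Proof. exact: (is_derive_cos_comp (is_derive_lin b x)). Qed.

Lemma sin_natpi n : sin (n%:R * pi) = 0 :> R.
Proof.
elim: n => [|n IH]; first by rewrite mul0r sin0.
by rewrite -natr1 mulrDl mul1r sinDpi IH oppr0.
Qed.

Lemma cos_natpi n : cos (n%:R * pi) = (-1) ^+ n :> R.
Proof.
elim: n => [|n IH]; first by rewrite mul0r cos0.
by rewrite -natr1 mulrDl mul1r cosDpi IH exprS mulN1r.
Qed.

(** The integrands add up to the derivative of p' (x) sin (b x) - b p (x) cos
    (b x). *)
Lemma green_sin (p p1 q : R -> R) b : C01 p -> C01 p1 -> C01 q ->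
  (forall x : R, x \in `]0, 1[ -> is_derive x 1 p (p1 x)) ->
  (forall x : R, x \in `]0, 1[ -> is_derive x 1 p1 (q x)) -> sin b = 0 ->
  I01 (fun x => q x * sin (b * x)) + b ^+ 2 * I01 (fun x => p x * sin (b * x)) =
  b * (p 0 - p 1 * cos b).
Proof.
move=> cp cp1 cq dp dp1 sb.
have cs := @C01_sinM R b; have cc := @C01_cosM R b.
rewrite -I01Z; last exact: C01M.
rewrite -I01D; [|exact: C01M|by apply: C01M; [exact: C01_cst|exact: C01M]].
pose F x := p1 x * sin (b * x) + - (b * (p x * cos (b * x))).
transitivity (F 1 - F 0); last by rewrite /F !mulr0 sin0 cos0 !mulr1 sb; ring.
apply: (@I01_FTC _ F).
- apply: C01D; first exact: C01M.
  by apply: C01N; apply: C01M; [exact: C01_cst|exact: C01M].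
- apply: C01D; first exact: C01M.
  by apply: C01M; [exact: C01_cst|exact: C01M].
- move=> x x01.
  have h1 := is_derive_mul (dp1 x x01) (is_derive_sinM b x).
  have h2 := is_derive_mul (dp x x01) (is_derive_cosM b x).
  apply: (is_derive_eq (is_derive_add h1 (is_derive_opp (is_derive_scale b h2)))).
  by ring.
Qed.

Definition half_delta (m n : nat) : R := if m == n then 1 / 2 else 0.

(** Different sines have different eigenvalues under the second derivative,
    and Green's formula makes them orthogonal. *)
Lemma sin_orthogonal (m n : nat) : (0 < m)%N -> (0 < n)%N ->
  I01 (fun y : R => sin (m%:R * pi * y) * sin (n%:R * pi * y)) =
  half_delta m n.
Proof.
rewrite /half_delta => m0 n0; have p0 := pi_gt0 R.
case: eqVneq => [<-|mn].
  have a0 : m%:R * pi != 0 :> R by rewrite mulf_neq0 ?gt_eqF// ltr0n.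
  pose F (y : R) := 2^-1 * y + - ((2 * (m%:R * pi))^-1 *
    (sin (m%:R * pi * y) * cos (m%:R * pi * y))).
  transitivity (F 1 - F 0); last first.
    by rewrite /F !mulr1 !mulr0 sin_natpi sin0 !mul0r !mulr0; lra.
  apply: (@I01_FTC _ F).
  - apply: C01D; first by apply: C01_continuous; exact: mulrl_continuous.
    apply: C01N; apply: C01M; first exact: C01_cst.
    by apply: C01M; [exact: C01_sinM|exact: C01_cosM].
  - by apply: C01M; exact: C01_sinM.
  - move=> x _.
    have h := is_derive_mul (is_derive_sinM (m%:R * pi) x) (is_derive_cosM (m%:R * pi) x).
    apply: (is_derive_eq (is_derive_add (is_derive_lin _ x)
      (is_derive_opp (is_derive_scale (2 * (m%:R * pi))^-1 h)))).
    set s := sin _; set c := cos _.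
    have -> : s * s = 2^-1 * (c ^+ 2 + s ^+ 2) - 2^-1 * (c ^+ 2 - s ^+ 2) by field.
    rewrite /s /c cos2Dsin2; move: a0; set a := _ * pi => a0.
    by field.
have := @green_sin (fun y => sin (m%:R * pi * y)) (fun y => m%:R * pi * cos (m%:R * pi * y))
  (fun y => - (m%:R * pi) ^+ 2 * sin (m%:R * pi * y)) (n%:R * pi).
rewrite mulr0 sin0 mulr1 !sin_natpi mul0r subrr mulr0.
move=> /(_ (@C01_sinM R _)) /= H.
have {H} : (- (m%:R * pi) ^+ 2 + (n%:R * pi) ^+ 2) *
  I01 (fun y : R => sin (m%:R * pi * y) * sin (n%:R * pi * y)) = 0.
  rewrite mulrDl -[in X in X + _]I01Z; last by apply: C01M; exact: C01_sinM.
  under [X in X + _]eq_I01 do rewrite mulrA.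
  apply: H => //.
  - by apply: C01M; [exact: C01_cst|exact: C01_cosM].
  - by apply: C01M; [exact: C01_cst|exact: C01_sinM].
  - by move=> x _; exact: is_derive_sinM.
  - move=> x _; apply: (is_derive_eq (is_derive_scale (m%:R * pi) (is_derive_cosM _ x))).
    by ring.
move/eqP; rewrite mulf_eq0 => /orP[|/eqP//].
rewrite addrC subr_eq0 eqf_sqr => /orP[/eqP|].
  move/(mulIf (negbT (gt_eqF p0)))/eqP; rewrite eqr_nat => /eqP nm.
  by rewrite nm eqxx in mn.
rewrite -addr_eq0 gt_eqF// addr_gt0// mulr_gt0// ltr0n//.
Qed.

End Derive1.

(** * Linear equations of second order, and integrals with a parameter *)

Section ODE.
Context {R : realType}.
Implicit Types F : R -> R.

Lemma derive0_constant (G : R -> R) :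
  (forall x : R, x \in `]0, 1[ -> is_derive x 1 G 0) ->
  exists c, forall x : R, x \in `]0, 1[ -> G x = c.
Proof.
move=> dG; exists (G (1 / 2)) => x x01.
have h : (1 / 2 : R) \in `]0, 1[ by rewrite in_itv/=; apply/andP; split; lra.
have := @MVT_bound _ G (fun=> 0) 0 1 0 x (1 / 2) x01 h dG.
rewrite mul0r => /(_ _)/wrap[|]; first by move=> y _; rewrite normr0.
by rewrite normr_le0 subr_eq0 => /eqP.
Qed.

(** The derivative of F^2 is nondecreasing, and a convex nonnegative function
    which is zero at both ends is zero: otherwise the mean value theorem gives
    a positive slope followed by a negative one. *)
Lemma ode_convex F F1 (k : R) : 0 <= k -> C01 F -> F 0 = 0 -> F 1 = 0 ->
  (forall x : R, x \in `]0, 1[ -> is_derive x 1 F (F1 x)) ->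
  (forall x : R, x \in `]0, 1[ -> is_derive x 1 F1 (k * F x)) ->
  forall x : R, x \in `[0, 1] -> F x = 0.
Proof.
move=> k0 cF F00 F10 dF dF1; apply: C01_eq0 => // x x01.
pose G x := F x * F x; pose G1 x := F1 x * F x + F x * F1 x.
have cG : C01 G by exact: C01M.
have dG (y : R) : y \in `]0, 1[ -> is_derive y 1 G (G1 y).
  by move=> y01; apply: is_derive_mul; exact: dF.
have G1mono (y z : R) : y \in `]0, 1[ -> z \in `]0, 1[ -> y < z -> G1 y <= G1 z.
  move=> y01 z01 yz.
  have dG1 (t : R) : t \in `]0, 1[ -> is_derive t 1 G1 (2 * (F1 t ^+ 2 + k * F t ^+ 2)).
    move=> t01; have h1 := dF t t01; have h2 := dF1 t t01.
    apply: (is_derive_eq (is_derive_add (is_derive_mul h2 h1) (is_derive_mul h1 h2))).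
    by ring.
  have yzsub (t : R) : t \in `[y, z] -> t \in `]0, 1[.
    move: y01 z01; rewrite !in_itv/= => /andP[? ?] /andP[? ?] /andP[? ?].
    by apply/andP; split; lra.
  have dG1' (t : R) : t \in `]y, z[%R -> is_derive t 1 G1 (2 * (F1 t ^+ 2 + k * F t ^+ 2)).
    by move=> tyz; apply: dG1; apply: yzsub; exact: subset_itv_oo_cc tyz.
  have cG1 : {within `[y, z], continuous G1}.
    by apply: derivable_within_continuous => t tyz; have [] := dG1 t (yzsub _ tyz).
  have [c _ e] := MVT yz dG1' cG1.
  rewrite -subr_ge0 e mulr_ge0//; last by rewrite subr_ge0 ltW.
  apply: mulr_ge0 => //; apply: addr_ge0; first exact: sqr_ge0.
  by rewrite mulr_ge0// sqr_ge0.
apply/eqP; apply/negPn/negP => Fx0.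
have Gx : 0 < G x by rewrite /G -expr2 exprn_even_gt0.
have [x0 x1] : 0 < x /\ x < 1 by move: x01; rewrite in_itv/= => /andP[].
have dGl (y : R) : y \in `]0, x[%R -> is_derive y 1 G (G1 y).
  rewrite in_itv/= => /andP[y0 yx].
  by apply: dG; rewrite in_itv/= y0 (lt_trans yx).
have cGl : {within `[0, x], continuous G}.
  by apply: continuous_subspaceW cG => y; rewrite /= !in_itv/= => /andP[-> yx]/=; lra.
have [y yx e1] := MVT x0 dGl cGl.
have dGr (z : R) : z \in `]x, 1[%R -> is_derive z 1 G (G1 z).
  rewrite in_itv/= => /andP[z0 zx].
  by apply: dG; rewrite in_itv/= zx (lt_trans x0).
have cGr : {within `[x, 1], continuous G}.
  apply: continuous_subspaceW cG => z; rewrite /= !in_itv/= => /andP[? ->].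
  by rewrite andbT; lra.
have [z zx e2] := MVT x1 dGr cGr.
have G0 : G 0 = 0 by rewrite /G F00 mul0r.
have G11 : G 1 = 0 by rewrite /G F10 mul0r.
move: e1 e2; rewrite G0 G11 !subr0 sub0r => e1 e2.
move: yx zx; rewrite !in_itv/= => /andP[? ?] /andP[? ?].
have := @G1mono y z; rewrite !in_itv/= => /(_ _ _ _)/wrap[|||].
- by apply/andP; split; lra.
- by apply/andP; split; lra.
- by lra.
have : 0 < G1 y by rewrite -(pmulr_lgt0 _ x0) -e1.
have : G1 z < 0 by rewrite -(pmulr_llt0 _ (_ : 0 < 1 - x)) ?subr_gt0// -e2 oppr_lt0.
by move=> ? ?; lra.
Qed.

(** The functions F' sin (w x) - w F cos (w x) and F' cos (w x) + w F sin (w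
    x) are constant, and F is recovered from them. *)
Lemma ode_sine F F1 (w : R) : 0 < w -> C01 F -> F 0 = 0 -> F 1 = 0 ->
  (forall x : R, x \in `]0, 1[ -> is_derive x 1 F (F1 x)) ->
  (forall x : R, x \in `]0, 1[ -> is_derive x 1 F1 (- w ^+ 2 * F x)) ->
  exists2 c, (forall x : R, x \in `[0, 1] -> F x = c * sin (w * x)) & c * sin w = 0.
Proof.
move=> w0 cF F00 F10 dF dF1.
have [a Ha] : exists a, forall x : R, x \in `]0, 1[ ->
    F1 x * sin (w * x) - w * (F x * cos (w * x)) = a.
  apply: derive0_constant => x x01.
  have h1 := is_derive_mul (dF1 x x01) (is_derive_sinM w x).
  have h2 := is_derive_mul (dF x x01) (is_derive_cosM w x).
  apply: (is_derive_eq (is_derive_add h1 (is_derive_opp (is_derive_scale w h2)))).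
  by ring.
have [b Hb] : exists b, forall x : R, x \in `]0, 1[ ->
    F1 x * cos (w * x) + w * (F x * sin (w * x)) = b.
  apply: derive0_constant => x x01.
  have h1 := is_derive_mul (dF1 x x01) (is_derive_cosM w x).
  have h2 := is_derive_mul (dF x x01) (is_derive_sinM w x).
  apply: (is_derive_eq (is_derive_add h1 (is_derive_scale w h2))).
  by ring.
have E : forall x : R, x \in `[0, 1] ->
    w * F x + - (b * sin (w * x) + - (a * cos (w * x))) = 0.
  apply: C01_eq0.
    apply: C01D; first by apply: C01M => //; exact: C01_cst.
    apply: C01N; apply: C01D; first by apply: C01M; [exact: C01_cst|exact: C01_sinM].
    by apply: C01N; apply: C01M; [exact: C01_cst|exact: C01_cosM].
  move=> x x01; rewrite -(Ha x x01) -(Hb x x01).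
  set s := sin _; set c := cos _.
  rewrite (_ : _ + _ = w * F x * (1 - (c ^+ 2 + s ^+ 2))); last by ring.
  by rewrite cos2Dsin2 subrr mulr0.
have a0 : a = 0.
  have := E 0; rewrite in_itv/= lexx ler01 => /(_ isT).
  by rewrite F00 !mulr0 sin0 cos0; lra.
exists (b / w) => [x x01|].
  have := E x x01; rewrite a0 mul0r oppr0 addr0 => /eqP; rewrite subr_eq0 => /eqP e.
  by rewrite mulrAC -e mulrC mulKf// gt_eqF.
have := E 1; rewrite in_itv/= lexx ler01 => /(_ isT).
rewrite F10 a0 mulr0 mul0r oppr0 addr0 add0r mulr1 => /eqP; rewrite oppr_eq0 => /eqP e.
by rewrite mulrAC e mul0r.
Qed.

End ODE.

Section UnderIntegral.
Context {R : realType}.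
Notation mu := (@lebesgue_measure R).
Implicit Types (v w : R * R -> R).

Lemma punctured_vertical (x y : R) : x \in `]0, 1[ -> y \in `[0, 1] ->
  punctured (x, y).
Proof.
rewrite !in_itv/= => /andP[x0 x1] /andP[y0 y1]; split.
  by apply/closure_squareP => /=; rewrite y0 y1 !ltW.
by case=> /= -[] xE _; move: xE x0 x1 => ->; rewrite ltxx.
Qed.

Lemma C01_slice v (x : R) : {within punctured, continuous v} -> x \in `]0, 1[ ->
  C01 (fun y => v (x, y)).
Proof.
move=> cv x01; apply: (within_continuous_comp_sub (phi := fun y => (x, y)) _ _ cv).
  by move=> y y01; exact: punctured_vertical.
apply: continuous_subspaceT => y.
exact: (cvg_pair (cvg_cst x) cvg_id).
Qed.

(** The rectangle is compact and avoids the vertices. *)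
Lemma punctured_bounded w (a b : R) : 0 < a -> b < 1 ->
  {within punctured, continuous w} ->
  exists K, 0 <= K /\ forall x y : R, x \in `[a, b] -> y \in `[0, 1] -> `|w (x, y)| <= K.
Proof.
move=> a0 b1 cw.
have cK : compact (`[a, b] `*` `[(0 : R), 1]).
  by apply: compact_setX; exact: segment_compact.
have cw' : {within `[a, b] `*` `[(0 : R), 1], continuous w}.
  apply: continuous_subspaceW cw => -[x y] [/= xab y01].
  apply: punctured_vertical => //.
  by move: xab; rewrite !in_itv/= => /andP[? ?]; apply/andP; split; lra.
have /compact_bounded[M [_ mrt]] := continuous_compact cw' cK.
exists (`|M| + 1); split => [|x y xab y01]; first by rewrite addr_ge0.
by apply: mrt; [rewrite (le_lt_trans (ler_norm M))// ltrDl|exists (x, y)].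
Qed.

Lemma I01_oo (f : R -> R) : C01 f -> \int[mu]_(x in `]0, 1[) f x = I01 f.
Proof.
move=> cf; rewrite /I01.
rewrite -(@Rintegral_itv_obnd_cbnd _ 0 (BRight 1)); last first.
  by apply: integrableS (C01_integrable cf) => //; exact: subset_itv_oc_cc.
rewrite -(@Rintegral_itv_bndo_bndc _ (BRight 0) 1)//.
by apply: integrableS (C01_integrable cf) => //; exact: subset_itv_oo_cc.
Qed.

(** Both v and w may be unbounded at the vertices, but the integral over y at
    a point near x only sees a rectangle where they are bounded. *)
Lemma is_derive_I01 v w (s : R -> R) (x : R) :
  {within punctured, continuous v} -> {within punctured, continuous w} -> C01 s ->
  (forall z, square z -> is_derive z (axis ord0) v (w z)) -> x \in `]0, 1[ ->
  is_derive x 1 (fun t => I01 (fun y => v (t, y) * s y)) (I01 (fun y => w (x, y) * s y)).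
Proof.
move=> cv cw cs dv x01.
have [x0 x1] : 0 < x /\ x < 1 by move: x01; rewrite in_itv/= => /andP[].
pose a := x / 2; pose b := (1 + x) / 2.
have a0 : 0 < a by rewrite /a; lra.
have b1 : b < 1 by rewrite /b; lra.
have sub (t : R) : t \in `]a, b[ -> t \in `]0, 1[.
  by rewrite !in_itv/= => /andP[? ?]; apply/andP; split; lra.
have [K [K0 HK]] := punctured_bounded a0 b1 cw.
have [L [L0 HL]] := C01_bounded cs.
pose f (t y : R) := v (t, y) * s y.
have xab : `]a, b[%classic x.
  by rewrite /= in_itv/=; apply/andP; split; rewrite /a /b; lra.
have dvt (t y : R) : t \in `]0, 1[ -> y \in `]0, 1[ ->
    is_derive t 1 (f ^~ y) (w (t, y) * s y).
  move=> t01 y01; have sq : square (t, y) by split.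
  have := (is_derive_axis0 _ _ _ _).1 (dv _ sq) => h.
  apply: (is_derive_eq (is_derive_mul h (is_derive_cst (s y) t 1))).
  by rewrite mulr0 addr0.
have pE (t y : R) : t \in `]0, 1[ -> y \in `]0, 1[ ->
    partial1of2 f t y = w (t, y) * s y.
  by move=> t01 y01; rewrite partial1of2E; have [_ ->] := dvt t y t01 y01.
have := @cvg_differentiation_under_integral R _ (measurableTypeR R) mu f
  `]0, 1[ _ x a b xab _ _ (fun=> K * L) _ _ _.
move=> /(_ _ _ _ _ _ _)/wrap[||||||].
- by [].
- move=> t tab; have ct : C01 (fun y => v (t, y)) by apply: C01_slice => //; exact: sub.
  apply: integrableS (C01_integrable (C01M ct cs)) => //; exact: subset_itv_oo_cc.
- by move=> t y tab y01; have [] := dvt t y (sub _ tab) y01.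
- by move=> y; rewrite mulr_ge0.
- apply: (@integrableS _ _ _ mu `[0, 1]) => //; first exact: subset_itv_oo_cc.
  by apply: C01_integrable; exact: C01_cst.
- move=> t y tab y01; rewrite pE; [|exact: sub|exact: y01].
  suff : `|w (t, y) * s y| <= K * L by [].
  rewrite normrM ler_pM//.
    by apply: HK; [exact: subset_itv_oo_cc tab|exact: subset_itv_oo_cc y01].
  by apply: HL; exact: subset_itv_oo_cc y01.
have cI (t : R) : t \in `]0, 1[ -> C01 (fun y => v (t, y) * s y).
  by move=> t01; apply: C01M => //; exact: C01_slice.
have cW : C01 (fun y => w (x, y) * s y) by apply: C01M => //; exact: C01_slice.
have -> : \int[mu]_(y in `]0, 1[) partial1of2 f x y = I01 (fun y => w (x, y) * s y).
  by rewrite -I01_oo//; apply: eq_Rintegral => y /set_mem y01; exact: pE.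
move=> H.
suff h : h^-1 *: (I01 (fun y => v (h *: 1 + x, y) * s y) - I01 (fun y => v (x, y) * s y))
   @[h --> (0 : R)^'] --> I01 (fun y => w (x, y) * s y).
  apply: DeriveDef; last exact: (cvg_lim _ h).
  by apply/cvg_ex; exists (I01 (fun y => w (x, y) * s y)).
apply: cvg_trans H; apply: near_eq_cvg; near=> h.
have hx : h + x \in `]0, 1[ by near: h; exact: near_shift_itvoo.
by rewrite scaler1 !I01_oo//; exact: cI.
Unshelve. all: by end_near. Qed.

End UnderIntegral.

(** * Dirichlet eigenfunctions above the second eigenvalue *)

Section DirichletReal.
Context {R : realType}.
Notation mu := (@lebesgue_measure R).
Implicit Types (u : R * R -> R) (x y : R).

Lemma C01_slice_closed u x : {within closure square, continuous u} -> x \in `[0, 1] ->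
  C01 (fun y => u (x, y)).
Proof.
move=> cu x01; apply: (within_continuous_comp_sub (phi := fun y => (x, y)) _ _ cu).
  by move=> y y01; rewrite square_closureE.
by apply: continuous_subspaceT => y; exact: (cvg_pair (cvg_cst x) cvg_id).
Qed.

(** Clamping the first coordinate extends the integrand to an open interval
    around [0, 1], where the theorem on continuity of parametric integrals
    applies. *)
Lemma C01_I01_slice u (s : R -> R) : {within closure square, continuous u} -> C01 s ->
  C01 (fun x => I01 (fun y => u (x, y) * s y)).
Proof.
move=> cu cs.
pose clamp (x : R) := Num.min 1 (Num.max 0 x).
have clamp01 x : clamp x \in `[0, 1].
  by rewrite in_itv/= le_min ler01 le_max lexx ge_min lexx.
have clampE x : x \in `[0, 1] -> clamp x = x.
  by rewrite in_itv/= /clamp => /andP[/max_idPr-> /min_idPr->].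
have cclamp : continuous clamp.
  move=> x; rewrite /clamp.
  under eq_fun do rewrite minr_absE maxr_absE add0r sub0r normrN.
  have c1 : (fun t : R => (t + `|t|) / 2) @ x --> (x + `|x|) / 2.
    apply: cvgM; last exact: cvg_cst.
    by apply: cvgD; [exact: cvg_id|apply: cvg_norm; exact: cvg_id].
  apply: cvgM; last exact: cvg_cst.
  apply: cvgB; first by apply: cvgD => //; exact: cvg_cst.
  by apply: cvg_norm; apply: cvgB => //; exact: cvg_cst.
have cK : compact (closure (@square R)).
  by rewrite square_closureE; apply: compact_setX; exact: segment_compact.
have /compact_bounded[M [_ mrt]] := continuous_compact cu cK.
have [L [L0 HL]] := C01_bounded cs.
pose f (x y : R) := u (clamp x, y) * s y.
have cf x : C01 (f x) by apply: C01M => //; exact: C01_slice_closed.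
have := @continuity_under_integral R _ (measurableTypeR R) mu f `[0, 1] _ (-1) 2 _ _
  (fun=> (`|M| + 1) * L) _ _.
move=> /(_ _ _ _ _ _)/wrap[|||||cF].
- by [].
- by move=> x _; exact: C01_integrable.
- apply: aeW => y y01 x _.
  suff h : (fun l => u (clamp l, y)) @ x --> u (clamp x, y).
    exact: (cvgM h (cvg_cst _)).
  have cuy : {within `[0, 1], continuous (fun x => u (x, y))}.
    apply: (within_continuous_comp_sub (phi := fun x => (x, y)) _ _ cu).
      by move=> t t01; rewrite square_closureE.
    by apply: continuous_subspaceT => t; exact: (cvg_pair cvg_id (cvg_cst y)).
  have sub t : [set: R] t -> `[0, 1]%classic (clamp t) by move=> _; exact: clamp01.
  have := within_continuous_comp_sub sub (continuous_subspaceT cclamp) cuy.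
  move=> H; exact: ((continuous_subspace_setT _).2 H x).
- by apply: C01_integrable; exact: C01_cst.
- move=> x _; apply: aeW => y y01.
  suff : `|u (clamp x, y) * s y| <= (`|M| + 1) * L by [].
  rewrite normrM ler_pM//; last exact: HL.
  apply: mrt; first by rewrite (le_lt_trans (ler_norm M))// ltrDl.
  by exists (clamp x, y) => //; rewrite square_closureE; split => //=; exact: clamp01.
apply: (@subspace_eq_continuous _ _ _ (fun x => I01 (f x))).
  move=> x /set_mem x01; apply: eq_I01 => y _.
  by rewrite /f clampE.
apply: continuous_in_subspaceT => x /set_mem; rewrite /= in_itv/= => /andP[? ?].
by apply: cF; rewrite inE/= in_itv/=; apply/andP; split; lra.
Qed.

Lemma sin_zero_lt2pi (w : R) : 0 < w -> w < pi * 2 -> sin w = 0 -> w = pi.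
Proof.
move=> w0 w2 sw; have [wp|wp|//] := ltgtP w pi.
  by have := sin_gt0_pi (x := w); rewrite w0 wp sw ltxx => /(_ isT).
have := sin_gt0_pi (x := w - pi).
rewrite sinB cospi sinpi sw mul0r mulr0 subrr ltxx => h.
by have : false by apply: h; apply/andP; split; lra.
Qed.

(** Two derivatives in x are taken under the integral sign, and the two in y
    are moved to the sine by Green's formula, without boundary terms since u
    vanishes on the sides. *)
Lemma dirichlet_sine_coef u (lam : R) : C2_closure u ->
  (forall z, square_boundary z -> u z = 0) ->
  (forall z, square z -> 2^-1 * laplacian u z = lam * u z) ->
  forall n, exists F1 : R -> R,
  let F x := I01 (fun y => u (x, y) * sin (n%:R * pi * y)) in
  [/\ C01 F, F 0 = 0 /\ F 1 = 0,
    (forall x : R, x \in `]0, 1[ -> is_derive x 1 F (F1 x)) &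
    (forall x : R, x \in `]0, 1[ -> is_derive x 1 F1 ((2 * lam + (n%:R * pi) ^+ 2) * F x))].
Proof.
move=> /C2_closureE[U [V [cu dU cU dV [cV lapE]]]] u0 eqn n.
pose s y : R := sin (n%:R * pi * y).
have cs : C01 s by exact: C01_sinM.
have cup : {within punctured, continuous u}.
  by apply: continuous_subspaceW cu => z [].
have u0' x y : x \in `[0, 1] -> y \in `[0, 1] -> (x == 0) || (x == 1) || (y == 0) || (y == 1) ->
    u (x, y) = 0.
  move=> x01 y01 h; apply: u0; split; first by rewrite square_closureE.
  move/squareE => /= [/andP[? ?] /andP[? ?]].
  by case/orP: h => [/orP[/orP[]|]|] /eqP; lra.
have u00 : (0 : R) \in `[0, 1] by rewrite in_itv/= lexx ler01.
have u01 : (1 : R) \in `[0, 1] by rewrite in_itv/= lexx ler01.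
exists (fun x => I01 (fun y => U ord0 (x, y) * s y)) => F.
have F0 x : x = 0 \/ x = 1 -> F x = 0.
  move=> h; rewrite /F (@eq_I01 _ _ (fun=> 0)) ?I01_cst// => y y01.
  by rewrite u0' ?mul0r//; case: h => ->; rewrite ?eqxx ?orbT//.
split.
- exact: C01_I01_slice.
- by split; apply: F0; [left|right].
- by move=> x x01; apply: is_derive_I01 => //; exact: dU.
move=> x x01.
have dF1 : is_derive x 1 (fun x => I01 (fun y => U ord0 (x, y) * s y))
    (I01 (fun y => V ord0 ord0 (x, y) * s y)).
  by apply: is_derive_I01 => //; exact: dV.
have x01' : x \in `[0, 1] by exact: subset_itv_oo_cc x01.
apply: (is_derive_eq dF1).
have cux : C01 (fun y => u (x, y)) by exact: C01_slice.
have cU1 : C01 (fun y => U ord_max (x, y)) by exact: C01_slice.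
have cV0 : C01 (fun y => V ord0 ord0 (x, y)) by exact: C01_slice.
have cV1 : C01 (fun y => V ord_max ord_max (x, y)) by exact: C01_slice.
have sq y : y \in `]0, 1[ -> square (x, y) by [].
have green : I01 (fun y => V ord_max ord_max (x, y) * s y) + (n%:R * pi) ^+ 2 * F x = 0.
  have := @green_sin _ (fun y => u (x, y)) (fun y => U ord_max (x, y))
    (fun y => V ord_max ord_max (x, y)) (n%:R * pi) cux cU1 cV1.
  rewrite !u0' ?eqxx ?orbT// mul0r subrr mulr0.
  apply; last exact: sin_natpi.
  - by move=> y y01; apply/is_derive_axis1; apply: dU; exact: sq.
  - by move=> y y01; apply/is_derive_axis1; apply: dV; exact: sq.
have E : forall y, y \in `[0, 1] ->
    V ord0 ord0 (x, y) + V ord_max ord_max (x, y) + - (2 * lam * u (x, y)) = 0.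
  apply: C01_eq0.
    apply: C01D; first exact: C01D.
    by apply: C01N; apply: C01M => //; exact: C01_cst.
  move=> y y01; rewrite -lapE; last exact: sq.
  by have := eqn _ (sq _ y01); lra.
have -> : I01 (fun y => V ord0 ord0 (x, y) * s y) =
    I01 (fun y => 2 * lam * (u (x, y) * s y) + - (V ord_max ord_max (x, y) * s y)).
  apply: eq_I01 => y y01; have := E y y01 => /eqP; rewrite subr_eq0 => /eqP e.
  by rewrite mulrA -e; ring.
have cus : C01 (fun y => u (x, y) * s y) by exact: C01M.
rewrite I01D; first last.
- by apply: C01N; exact: C01M.
- by apply: C01M => //; exact: C01_cst.
rewrite I01N; last exact: C01M.
rewrite I01Z// -/(F x) mulrDl.
by move: green; lra.
Qed.

(** The n-th sine coefficient solves F'' = k F. For n >= 2, k > - pi^2 and F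
    vanishes; for n = 1, k > - 4 pi^2 and F is a multiple of sin (pi x), which
    is zero unless k = - pi^2. Completeness of the sines determines u. *)
Lemma dirichlet_eigen_real u (lam : R) : C2_closure u ->
  (forall z, square_boundary z -> u z = 0) ->
  (forall z, square z -> 2^-1 * laplacian u z = lam * u z) ->
  - (5 * pi ^+ 2 / 2) < lam ->
  exists2 c, (forall z, closure square z -> u z = c * (sin (pi * z.1) * sin (pi * z.2))) &
    lam != - pi ^+ 2 -> c = 0.
Proof.
move=> uC2 u0 eqn lamgt.
have p0 := pi_gt0 R.
have p20 : 0 < pi ^+ 2 :> R by rewrite exprn_gt0.
have cu : {within closure square, continuous u} by have [] := uC2.
have coef := dirichlet_sine_coef uC2 u0 eqn.
pose F n x := I01 (fun y => u (x, y) * sin (n%:R * pi * y)).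
have Fhigh n x : x \in `[0, 1] -> F n.+2 x = 0.
  have [F1 [cF [F00 F10] dF dF1]] := coef n.+2.
  have n2 : 4 <= n.+2%:R ^+ 2 :> R.
    by rewrite -natrX ler_nat -[4%N]/(2 ^ 2)%N leq_exp2r.
  set k := 2 * lam + (n.+2%:R * pi) ^+ 2 in dF1.
  have kgt : - pi ^+ 2 < k by rewrite /k exprMn; nra.
  have [k0|k0] := leP 0 k; first by move=> ?; exact: (ode_convex k0 cF F00 F10 dF dF1).
  pose w := Num.sqrt (- k).
  have w2 : - w ^+ 2 = k by rewrite sqr_sqrtr ?opprK// oppr_ge0 ltW.
  have w0 : 0 < w by rewrite sqrtr_gt0 oppr_gt0.
  have wp : w < pi by rewrite -(ltr_pXn2r (_ : 0 < 2)%N) ?nnegrE ?ltW//; lra.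
  rewrite -w2 in dF1.
  have [c Fc cs] := ode_sine w0 cF F00 F10 dF dF1.
  move=> x01; rewrite /F Fc//.
  move/eqP: cs; rewrite mulf_eq0 => /orP[/eqP->|/eqP sw]; first by rewrite mul0r.
  by have := sin_gt0_pi (x := w); rewrite w0 wp sw ltxx => /(_ isT).
have [c [Fc c0]] : exists c, (forall x, x \in `[0, 1] -> F 1%N x = c * sin (pi * x)) /\
    (lam != - pi ^+ 2 -> c = 0).
  have [F1 [cF [F00 F10] dF dF1]] := coef 1%N.
  set k := 2 * lam + (1%:R * pi) ^+ 2 in dF1.
  have kE : k = 2 * lam + pi ^+ 2 by rewrite /k mul1r.
  have kgt : - (pi * 2) ^+ 2 < k by rewrite kE exprMn; nra.
  have [k0|k0] := leP 0 k.
    exists 0; split => // x x01; rewrite mul0r.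
    exact: (ode_convex k0 cF F00 F10 dF dF1).
  pose w := Num.sqrt (- k).
  have w2 : - w ^+ 2 = k by rewrite sqr_sqrtr ?opprK// oppr_ge0 ltW.
  have w0 : 0 < w by rewrite sqrtr_gt0 oppr_gt0.
  have wp : w < pi * 2.
    by rewrite -(ltr_pXn2r (_ : 0 < 2)%N) ?nnegrE ?ltW ?mulr_gt0//; lra.
  rewrite -w2 in dF1.
  have [c Fc cs] := ode_sine w0 cF F00 F10 dF dF1.
  move/eqP: cs; rewrite mulf_eq0 => /orP[/eqP c0|/eqP sw].
    by exists 0; split => // x x01; rewrite /F Fc// c0 !mul0r.
  have wE := sin_zero_lt2pi w0 wp sw.
  exists c; split => [x x01|/eqP]; first by rewrite /F Fc// wE.
  by case; move: w2; rewrite wE kE; lra.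
exists (2 * c) => [[x y] /closure_squareP[/= x01 y01]|/c0->]; last by rewrite mulr0.
have x01' : x \in `[0, 1] by rewrite in_itv.
have cux : C01 (fun y => u (x, y)) by exact: C01_slice_closed.
have cs n : C01 (fun y : R => sin (n%:R * pi * y)) by exact: C01_sinM.
suff : forall y, y \in `[0, 1] ->
    u (x, y) + - ((2 * c * sin (pi * x)) * sin (1%:R * pi * y)) = 0.
  by move=> /(_ y); rewrite in_itv => /(_ y01) /eqP; rewrite subr_eq0 mul1r mulrA => /eqP.
apply: sine_complete.
  by apply: C01D => //; apply: C01N; apply: C01M => //; exact: C01_cst.
move=> n.
rewrite (@eq_I01 _ _ (fun y => u (x, y) * sin (n.+1%:R * pi * y) +
  - (2 * c * sin (pi * x) * (sin (1%:R * pi * y) * sin (n.+1%:R * pi * y))))); last first.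
  by move=> t _; ring.
have c1 : C01 (fun y => sin (1%:R * pi * y) * sin (n.+1%:R * pi * y)) by exact: C01M.
rewrite I01D; first last.
- by apply: C01N; apply: C01M => //; exact: C01_cst.
- exact: C01M.
rewrite I01N; last by apply: C01M => //; exact: C01_cst.
rewrite I01Z// sin_orthogonal// /half_delta -/(F n.+1 x).
case: n {c1} => [|n]; first by rewrite eqxx Fc//; field.
by rewrite Fhigh//= mulr0 subr0.
Qed.

End DirichletReal.

(** * The second Dirichlet eigenvalue *)

Section SmoothProducts.
Context {R : realType}.
Implicit Types (p q : R -> R) (u : R * R -> R).

Lemma ord2P (i : 'I_2) : i = ord0 \/ i = ord_max.
Proof. by case: i => -[|[|//]] ?; [left|right]; apply: val_inj. Qed.

Lemma continuous_prod_fun p q : continuous p -> continuous q ->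
  continuous (fun z : R * R => p z.1 * q z.2).
Proof.
move=> cp cq z; apply: cvgM.
  by apply: (@continuous_comp _ _ _ fst p); [exact: cvg_fst|exact: cp].
by apply: (@continuous_comp _ _ _ snd q); [exact: cvg_snd|exact: cq].
Qed.

Lemma is_derive_continuous p (p1 : R -> R) :
  (forall x : R, is_derive x 1 p (p1 x)) -> continuous p.
Proof.
move=> dp x; apply: differentiable_continuous; apply/derivable1_diffP.
by have [] := dp x.
Qed.

Lemma C2_product p p1 p2 q q1 q2 :
  (forall x : R, is_derive x 1 p (p1 x)) -> (forall x : R, is_derive x 1 p1 (p2 x)) ->
  (forall x : R, is_derive x 1 q (q1 x)) -> (forall x : R, is_derive x 1 q1 (q2 x)) ->
  continuous p2 -> continuous q2 ->
  let u z := p z.1 * q z.2 in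
  C2_closure u /\ forall z, square z -> laplacian u z = p2 z.1 * q z.2 + p z.1 * q2 z.2.
Proof.
move=> dp dp1 dq dq1 cp2 cq2 u.
have cp := is_derive_continuous dp; have cp1 := is_derive_continuous dp1.
have cq := is_derive_continuous dq; have cq1 := is_derive_continuous dq1.
pose U (i : 'I_2) (z : R * R) := if i == ord0 then p1 z.1 * q z.2 else p z.1 * q1 z.2.
pose V (i j : 'I_2) (z : R * R) := if i == ord0 then
    if j == ord0 then p2 z.1 * q z.2 else p1 z.1 * q1 z.2
  else if j == ord0 then p1 z.1 * q1 z.2 else p z.1 * q2 z.2.
have dx (f g f1 : R -> R) (z : R * R) : (forall x : R, is_derive x 1 f (f1 x)) ->
    is_derive z (axis ord0) (fun z => f z.1 * g z.2) (f1 z.1 * g z.2).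
  case: z => x y df; apply/is_derive_axis0 => /=.
  apply: (is_derive_eq (is_derive_mul (df x) (is_derive_cst (g y) x 1))).
  by rewrite mulr0 addr0.
have dy (f g g1 : R -> R) (z : R * R) : (forall x : R, is_derive x 1 g (g1 x)) ->
    is_derive z (axis ord_max) (fun z => f z.1 * g z.2) (f z.1 * g1 z.2).
  case: z => x y dg; apply/is_derive_axis1 => /=.
  apply: (is_derive_eq (is_derive_mul (is_derive_cst (f x) y 1) (dg y))).
  by rewrite mul0r add0r.
have := @C2_closureI _ u U V; apply.
- by apply: continuous_subspaceT; exact: continuous_prod_fun.
- by move=> i z _; case: (ord2P i) => ->; rewrite /U/=; [exact: dx|exact: dy].
- by move=> i; case: (ord2P i) => ->; apply: continuous_subspaceT; exact: continuous_prod_fun.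
- by move=> i j z _; case: (ord2P i) => ->; case: (ord2P j) => ->;
    rewrite /U /V/=; [exact: dx|exact: dy|exact: dx|exact: dy].
- by move=> i j; case: (ord2P i) => ->; case: (ord2P j) => ->;
    apply: continuous_subspaceT; exact: continuous_prod_fun.
Qed.

Lemma C2_sine_mode (m n : nat) :
  let u (z : R * R) := sin (m%:R * pi * z.1) * sin (n%:R * pi * z.2) in
  C2_closure u /\ forall z, square z ->
    laplacian u z = - ((m%:R ^+ 2 + n%:R ^+ 2) * pi ^+ 2) * u z.
Proof.
have d1 (k x : R) : is_derive x 1 (fun x => k * cos (k * x)) (- k ^+ 2 * sin (k * x)).
  by apply: (is_derive_eq (is_derive_scale k (is_derive_cosM k x))); ring.
have c2 (k : R) : continuous (fun x => - k ^+ 2 * sin (k * x)).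
  by move=> x; apply: cvgM; [exact: cvg_cst|exact: continuous_sinM].
have [C2u lapu] := C2_product (is_derive_sinM (m%:R * pi)) (d1 _)
  (is_derive_sinM (n%:R * pi)) (d1 _) (c2 _) (c2 _).
split=> // z sz; rewrite lapu//; ring.
Qed.

End SmoothProducts.

Section ComplexEigen.
Context {R : realType}.
Local Open Scope complex_scope.
Implicit Types (f : R * R -> R[i]) (u : R * R -> R) (lam : R).

Lemma real_complexM (a b c : R) : a%:C * (b +i* c) = (a * b) +i* (a * c).
Proof. by simpc. Qed.

Lemma complex_pairI (a b c d : R) : a +i* b = c +i* d -> a = c /\ b = d.
Proof. by case. Qed.

(** Multiplication by a real number acts separately on the real and imaginary
    parts. *)
Lemma half_laplacian_realP lam f : half_laplacian_eq lam%:C f <->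
  (forall z, square z -> 2^-1 * laplacian (reC f) z = lam * reC f z) /\
  (forall z, square z -> 2^-1 * laplacian (imC f) z = lam * imC f z).
Proof.
have half : 2^-1 = (2^-1)%:C :> R[i].
  by rewrite fmorphV rmorph_nat.
have E z : (2^-1 * laplacianC f z = lam%:C * f z) <->
    (2^-1 * laplacian (reC f) z = lam * reC f z /\
     2^-1 * laplacian (imC f) z = lam * imC f z).
  rewrite half /laplacianC real_complexM.
  have -> : f z = reC f z +i* imC f z by rewrite /reC /imC; case: (f z).
  rewrite real_complexM.
  split=> [/complex_pairI //|[e1 e2]].
  exact: (f_equal2 (@Complex R) e1 e2).
split=> [H|[H1 H2] z sz]; last by apply/E; split; [exact: H1|exact: H2].
by split=> z sz; have /E[] := H z sz.
Qed.

Lemma laplacian_cst (k : R) (z : R * R) : laplacian (fun=> k) z = 0.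
Proof.
rewrite laplacianE /partial.
have -> (a : R * R) : derive (fun=> k) ^~ a = fun=> 0 by apply/funext => w; exact: derive_cst.
by rewrite !derive_cst addr0.
Qed.

Lemma C2_cst (k : R) : C2_closure (fun _ : R * R => k).
Proof.
have d0 (l x : R) : is_derive x 1 (fun=> l : R) 0 by exact: is_derive_cst.
have c0 : continuous (fun _ : R => 0 : R) by move=> x; exact: cvg_cst.
have [+ _] := C2_product (d0 k) (d0 0) (d0 1) (d0 0) c0 c0.
by rewrite /= mulr1.
Qed.

Lemma dirichlet_eigenspace_real lam u : C2_closure u ->
  (forall z, square_boundary z -> u z = 0) ->
  (forall z, square z -> 2^-1 * laplacian u z = lam * u z) ->
  dirichlet_eigenspace lam%:C (fun z => (u z)%:C).
Proof.
move=> C2u u0 eqn; split.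
- split; first exact: C2u.
  exact: (C2_cst 0).
- by move=> z bz; rewrite u0.
- apply/half_laplacian_realP; split; first exact: eqn.
  move=> z sz; rewrite [imC _](_ : _ = fun=> 0); last by apply/funext.
  by rewrite laplacian_cst !mulr0.
Qed.

Lemma boundaryP (z : R * R) : square_boundary z ->
  [\/ z.1 = 0, z.1 = 1, z.2 = 0 | z.2 = 1].
Proof.
move=> [/closure_squareP[/andP[x0 x1] /andP[y0 y1]] ns].
have [->|x0'] := eqVneq z.1 0; first exact: Or41.
have [->|x1'] := eqVneq z.1 1; first exact: Or42.
have [->|y0'] := eqVneq z.2 0; first exact: Or43.
have [->|y1'] := eqVneq z.2 1; first exact: Or44.
exfalso; apply: ns; apply/squareE.
by rewrite !lt_neqAle x0 x1 y0 y1 x1' y1' !(eq_sym 0) x0' y0'.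
Qed.

Lemma sine_mode_eigenspace (m n : nat) lam :
  2 * lam = - ((m%:R ^+ 2 + n%:R ^+ 2) * pi ^+ 2) ->
  dirichlet_eigenspace lam%:C
    (fun z : R * R => (sin (m%:R * pi * z.1) * sin (n%:R * pi * z.2))%:C).
Proof.
move=> lamE; have [C2u lapu] := @C2_sine_mode R m n.
apply: dirichlet_eigenspace_real => // z.
  by case/boundaryP => ->; rewrite ?mulr0 ?mulr1 ?sin0 ?sin_natpi ?mul0r ?mulr0.
by move=> sz; rewrite lapu// -lamE; field.
Qed.

Lemma dirichlet_eigenspaceP lam f : - (5 * pi ^+ 2 / 2) < lam ->
  dirichlet_eigenspace lam%:C f ->
  exists c : R[i], (forall z, closure square z ->
    f z = c * (sin (pi * z.1) * sin (pi * z.2))%:C) /\ (lam != - pi ^+ 2 -> c = 0).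
Proof.
move=> lamgt [[C2r C2i] f0 /half_laplacian_realP[er ei]].
have [a aE a0] : exists2 a, (forall z, closure square z ->
    reC f z = a * (sin (pi * z.1) * sin (pi * z.2))) & lam != - pi ^+ 2 -> a = 0.
  by apply: (dirichlet_eigen_real C2r) => // z /f0; rewrite /reC => ->.
have [b bE b0] : exists2 b, (forall z, closure square z ->
    imC f z = b * (sin (pi * z.1) * sin (pi * z.2))) & lam != - pi ^+ 2 -> b = 0.
  by apply: (dirichlet_eigen_real C2i) => // z /f0; rewrite /imC => ->.
exists (a +i* b); split => [z cz|h]; last by rewrite a0// b0.
have -> : f z = reC f z +i* imC f z by rewrite /reC /imC; case: (f z).
rewrite [RHS]mulrC real_complexM aE// bE//.
exact: (f_equal2 (@Complex R) (mulrC _ _) (mulrC _ _)).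
Qed.

Lemma sumr_delta (m : nat) (k : 'I_m) (b : 'I_m -> R * R -> R[i]) (a : R[i]) z :
  \sum_(j < m) [ffun j => if j == k then a else 0] j * b j z = a * b k z.
Proof.
rewrite (bigD1 k)//= ffunE eqxx big1 ?addr0// => j jk.
by rewrite ffunE (negbTE jk) mul0r.
Qed.

(** If b k were zero, it would have two expansions, with k-th coefficients 0
    and 1. *)
Lemma eigenbasis_free (lam : R[i]) m (b : 'I_m -> R * R -> R[i]) (k : 'I_m) :
  dirichlet_eigenbasis lam b -> ~ (forall z, closure square z -> b k z = 0).
Proof.
move=> [bE bu] bk0; have [c [_ cuniq]] := bu _ (bE k).
have h1 : c = [ffun j => if j == k then 1 else 0].
  by apply: cuniq => z cz; rewrite sumr_delta mul1r.
have h2 : c = [ffun j => if j == k then 0 else 0].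
  by apply: cuniq => z cz; rewrite sumr_delta mul0r bk0.
have : c k = c k by [].
by rewrite {1}h1 h2 !ffunE eqxx => /eqP; rewrite oner_eq0.
Qed.

Lemma eigenbasis_gt0 (lam : R[i]) m (b : 'I_m -> R * R -> R[i]) f z :
  dirichlet_eigenbasis lam b -> dirichlet_eigenspace lam f -> closure square z ->
  f z != 0 -> (0 < m)%N.
Proof.
case: m b => // b [_ bu] Ef cz; have [c [cE _]] := bu _ Ef.
by rewrite cE// big_ord0 eqxx.
Qed.

(** All eigenfunctions are multiples of a single function, so two elements of
    a basis would be proportional. *)
Lemma ground_state_simple m (b : 'I_m -> R * R -> R[i]) :
  dirichlet_eigenbasis (- pi ^+ 2)%:C b -> (m <= 1)%N.
Proof.
move=> bb; have [bE bu] := bb.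
have p20 : 0 < pi ^+ 2 :> R by rewrite exprn_gt0// pi_gt0.
have lamgt : - (5 * pi ^+ 2 / 2) < - pi ^+ 2 :> R by lra.
rewrite leqNgt; apply/negP => m2.
pose k0 : 'I_m := Ordinal (ltnW m2); pose k1 : 'I_m := Ordinal m2.
have [c0 [c0E _]] := dirichlet_eigenspaceP lamgt (bE k0).
have [c1 [c1E _]] := dirichlet_eigenspaceP lamgt (bE k1).
have c1n0 : c1 != 0.
  apply/eqP => c10; apply: (eigenbasis_free (k := k1) bb) => z cz.
  by rewrite c1E// c10 mul0r.
have [c [_ cuniq]] := bu _ (bE k0).
have h1 : c = [ffun j => if j == k0 then 1 else 0].
  by apply: cuniq => z cz; rewrite sumr_delta mul1r.
have h2 : c = [ffun j => if j == k1 then c0 / c1 else 0].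
  by apply: cuniq => z cz; rewrite sumr_delta c0E// c1E// mulrA divfK.
have : c k0 = c k0 by [].
by rewrite {1}h1 h2 !ffunE eqxx/= => /eqP; rewrite oner_eq0.
Qed.

(** Every eigenvalue other than - pi^2 is at most - 5 pi^2 / 2. Both numbers
    occur, with eigenfunctions sin (pi x) sin (pi y) and sin (pi x) sin (2 pi
    y), and the first occurs only once. Hence the monotone sequence starts
    with these two. *)
Lemma second_dirichlet_eigenvalue (lamD : nat -> R) : dirichlet_eigenvalues lamD ->
  lamD 1%N = - (5 * pi ^+ 2 / 2).
Proof.
move=> [mono spec].
have p0 := pi_gt0 R.
have p20 : 0 < pi ^+ 2 :> R by rewrite exprn_gt0.
have mono' m n : (m <= n)%N -> lamD n <= lamD m.
  by move=> mn; apply: (@nonincreasing_seqP _ _ lamD).1.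
have mem (lam : R) f z : dirichlet_eigenspace lam%:C f -> closure square z -> f z != 0 ->
    exists n, lamD n = lam.
  move=> Ef cz fz; have [m [b [bb cb]]] := spec lam%:C.
  have m0 := eigenbasis_gt0 bb Ef cz fz.
  have : [set n | (lamD n)%:C = lam%:C] !=set0.
    apply/set0P/eqP => e0; move: cb; rewrite e0 card_eq_sym card_eq0 => /eqP /IIn_eq0.
    by move=> m00; rewrite m00 in m0.
  by move=> [n /= [nE]]; exists n.
have low n : lamD n != - pi ^+ 2 -> lamD n <= - (5 * pi ^+ 2 / 2).
  move=> ln; rewrite leNgt; apply/negP => lgt.
  have [m [b [bb cb]]] := spec (lamD n)%:C.
  case: m b bb cb => [|m] b bb cb.
    move: cb; rewrite II0 card_eq0 => /eqP e0.
    by have : [set n0 | (lamD n0)%:C = (lamD n)%:C] n by []; rewrite e0.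
  have [c [cE c0]] := dirichlet_eigenspaceP lgt (bb.1 ord0).
  by apply: (eigenbasis_free (k := ord0) bb) => z cz; rewrite cE// c0// mul0r.
have [n1 n1E] : exists n, lamD n = - (5 * pi ^+ 2 / 2).
  apply: (mem _ _ (1 / 2, 1 / 4) (@sine_mode_eigenspace 1 2 _ _)).
  - by rewrite expr1n; field.
  - by apply/closure_squareP => /=; split; apply/andP; split; lra.
  - rewrite /= fmorph_eq0 mulf_neq0//.
      by rewrite mul1r mul1r sin_pihalf oner_neq0.
    by rewrite (_ : 2%:R * pi * (1 / 4) = pi / 2 :> R); [rewrite sin_pihalf oner_neq0|field].
have [n0 n0E] : exists n, lamD n = - pi ^+ 2.
  apply: (mem _ _ (1 / 2, 1 / 2) (@sine_mode_eigenspace 1 1 _ _)).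
  - by rewrite expr1n; field.
  - by apply/closure_squareP => /=; split; apply/andP; split; lra.
  - by rewrite /= fmorph_eq0 mulf_neq0// !mul1r sin_pihalf oner_neq0.
have uniq m n : lamD m = - pi ^+ 2 -> lamD n = - pi ^+ 2 -> m = n.
  move=> mE nE; have [k [b [bb cb]]] := spec (- pi ^+ 2)%:C.
  have k1 := ground_state_simple bb.
  move: cb => /card_eqPle[/pcard_leP/injfunPex[g gI ginj] _].
  have g0 j : lamD j = - pi ^+ 2 -> g j = 0%N.
    move=> jE; have : (g j < k)%N by apply: gI; rewrite /= jE.
    by move=> /leq_trans/(_ k1); rewrite ltnS leqn0 => /eqP.
  by apply: ginj; rewrite ?inE/= ?mE ?nE// !g0.
have lam0 : lamD 0%N = - pi ^+ 2.
  apply/eqP/negPn/negP => /low.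
  have := mono' 0%N n0 isT; rewrite n0E; lra.
have n1gt0 : (0 < n1)%N.
  by rewrite lt0n; apply/eqP => n10; move: n1E; rewrite n10 lam0; lra.
apply/eqP; rewrite eq_le; apply/andP; split.
  by apply: low; apply/eqP => /(uniq _ _ lam0).
by rewrite -n1E; exact: mono'.
Qed.

End ComplexEigen.

(** * Separated solutions of the Helmholtz equation *)

Section Waves.
Context {R : realType}.
Implicit Types (x y w k : R).

(** The l-th derivative of sin (w y + ph): each differentiation adds a quarter
    turn to the phase. *)
Definition wave (l : nat) w (ph : R) y := w ^+ l * sin (w * y + ph + l%:R * (pi / 2)).

Lemma is_derive_wave l w ph y : is_derive y 1 (wave l w ph) (wave l.+1 w ph y).
Proof.
have h := is_derive_sin_comp (is_derive_add (is_derive_add (is_derive_lin w y)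
  (is_derive_cst ph y 1)) (is_derive_cst (l%:R * (pi / 2)) y 1)).
apply: (is_derive_eq (is_derive_scale (w ^+ l) h)).
by rewrite /wave !addr0 -(natr1 l) [(_ + 1) * _]mulrDl mul1r addrA sinDpihalf exprSr; ring.
Qed.

Lemma wave2 l w ph y : wave l.+2 w ph y = - w ^+ 2 * wave l w ph y.
Proof.
have -> : wave l.+2 w ph y = w ^+ l.+2 * sin (w * y + ph + l%:R * (pi / 2) + pi / 2 + pi / 2).
  by rewrite /wave -(natr1 l.+1) -(natr1 l); congr (_ * sin _); ring.
by rewrite sinDpihalf cosDpihalf /wave !exprS; ring.
Qed.

Lemma normr_wave l w ph y : 0 <= w -> `|wave l w ph y| <= w ^+ l.
Proof.
move=> w0; rewrite /wave normrM normrX (ger0_norm w0) ler_piMr ?exprn_ge0//.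
exact: sin_max.
Qed.

Lemma continuous_wave l w ph : continuous (wave l w ph).
Proof. exact: is_derive_continuous (is_derive_wave l w ph). Qed.

Lemma wave0 w y : wave 0 w 0 y = sin (w * y).
Proof. by rewrite /wave expr0 mul1r mul0r !addr0. Qed.

(** The i-th derivative of cosh (k (x - 1/2)) / cosh (k / 2), written with
    exponentials that are bounded on [0, 1] for k >= 0. *)
Definition hyp (i : nat) k x :=
  k ^+ i * (expR (- (k * (1 - x))) + (-1) ^+ i * expR (- (k * x))) / (1 + expR (- k)).

Lemma is_derive_hyp i k x : is_derive x 1 (hyp i k) (hyp i.+1 k x).
Proof.
have h1 := is_derive_exp_comp (is_derive_opp (is_derive_scale k (is_derive_add
  (is_derive_cst (1 : R) x 1) (is_derive_opp (is_derive_id x 1))))).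
have h2 := is_derive_exp_comp (is_derive_opp (is_derive_lin k x)).
apply: (is_derive_eq (is_derive_mul (is_derive_scale (k ^+ i)
  (is_derive_add h1 (is_derive_scale ((-1) ^+ i) h2)))
  (is_derive_cst (1 + expR (- k))^-1 x 1))).
by rewrite /hyp !exprS /=; ring.
Qed.

Lemma hyp2 i k x : hyp i.+2 k x = k ^+ 2 * hyp i k x.
Proof. by rewrite /hyp !exprS; ring. Qed.

Lemma hyp_den k : 1 + expR (- k) != 0.
Proof. by rewrite gt_eqF// addr_gt0// expR_gt0. Qed.

Lemma hyp00 k : hyp 0 k 0 = 1.
Proof.
by rewrite /hyp !expr0 !mul1r subr0 mulr1 mulr0 oppr0 expR0 addrC divff// hyp_den.
Qed.

Lemma hyp01 k : hyp 0 k 1 = 1.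
Proof.
by rewrite /hyp !expr0 !mul1r subrr mulr1 mulr0 oppr0 expR0 divff// hyp_den.
Qed.

Lemma hyp_gt0 k x : 0 < hyp 0 k x.
Proof.
by rewrite /hyp !expr0 !mul1r divr_gt0// addr_gt0// expR_gt0.
Qed.

Lemma hyp_le1 k x : 0 <= k -> x \in `[0, 1] -> hyp 0 k x <= 1.
Proof.
move=> k0; rewrite in_itv/= => /andP[x0 x1].
rewrite /hyp !expr0 !mul1r ler_pdivrMr ?addr_gt0 ?expR_gt0// mul1r -subr_ge0.
have -> : - k = - (k * (1 - x)) + - (k * x) by ring.
rewrite expRD.
set a := expR (- (k * (1 - x))); set b := expR (- (k * x)).
have -> : 1 + a * b - (a + b) = (1 - a) * (1 - b) by ring.
by rewrite mulr_ge0// subr_ge0 -[leRHS]expR0 ler_expR oppr_le0 mulr_ge0// subr_ge0.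
Qed.

Lemma normr_hyp i k (d x : R) : 0 <= k -> d <= x -> d <= 1 - x ->
  `|hyp i k x| <= 2 * k ^+ i * expR (- (k * d)).
Proof.
move=> k0 dx dx1; rewrite /hyp !normrM normfV normrX (ger0_norm k0).
rewrite (@ger0_norm _ (1 + expR (- k))) ?addr_ge0 ?expR_ge0//.
rewrite ler_pdivrMr ?addr_gt0 ?expR_gt0//.
have -> : 2 * k ^+ i * expR (- (k * d)) * (1 + expR (- k)) =
   k ^+ i * (2 * expR (- (k * d)) * (1 + expR (- k))) by ring.
rewrite ler_wpM2l ?exprn_ge0//.
have e0 := expR_gt0 (- (k * d)).
have eK := expR_gt0 (- k).
apply: (@le_trans _ _ (2 * expR (- (k * d)))); last first.
  by rewrite ler_peMr ?mulr_ge0 ?expR_ge0// lerDl ltW.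
apply: (le_trans (ler_normD _ _)).
rewrite normrM normrX normrN1 expr1n mul1r !ger0_norm ?expR_ge0//.
have h1 : expR (- (k * (1 - x))) <= expR (- (k * d)) by rewrite ler_expR lerN2 ler_wpM2l.
have h2 : expR (- (k * x)) <= expR (- (k * d)) by rewrite ler_expR lerN2 ler_wpM2l.
lra.
Qed.

(** Exponential growth is compared with a power through e^(s / n) >= s / n. *)
Lemma exp_decay (p : nat) (d : R) : 0 < d ->
  exists C, 0 <= C /\ forall t, 0 <= t -> t ^+ p * expR (- (t * d)) <= C.
Proof.
move=> d0; pose q : R := d / p.+1%:R.
have q0 : 0 < q by rewrite divr_gt0.
exists (q ^- p); split; first by rewrite invr_ge0 exprn_ge0 ?ltW.
move=> t t0; rewrite expRN ler_pdivrMr ?expR_gt0//.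
have -> : t * d = p.+1%:R * (t * q) by rewrite /q; field.
rewrite expRM_natl.
have h : t * q <= expR (t * q) by have := expR_ge1Dx (t * q); lra.
have h1 : 1 <= expR (t * q) by rewrite -[leLHS]expR0 ler_expR mulr_ge0// ltW.
rewrite ler_pdivlMl ?exprn_gt0// mulrC -exprMn.
apply: (@le_trans _ _ (expR (t * q) ^+ p)).
  by rewrite lerXn2r ?nnegrE ?expR_ge0// mulr_ge0// ltW.
by rewrite ler_weXn2l.
Qed.

End Waves.

Section Coefficients.
Context {R : realType}.

(** The odd frequencies from 3 on. The frequency 1 is kept apart, since its
    profile in x oscillates instead of decaying. *)
Definition freq (j : nat) : R := (2 * j + 3)%N%:R.

(** These numbers are used as a summable majorant for all the series below. *)
Definition tau (j : nat) : R := (freq j ^+ 2 - 4)^-1.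

(** The rate for which sin (freq pi y) times a hyperbolic profile in x has
    Laplacian - 4 pi^2 times itself. *)
Definition decay (j : nat) : R := pi * Num.sqrt (freq j ^+ 2 - 4).

(** The sine coefficient of 1 - cos (2 pi y) at the frequency freq j. *)
Definition beta (j : nat) : R := - 16 / (pi * freq j) * tau j.

Lemma freqE j : freq j = 2 * j%:R + 3.
Proof. by rewrite /freq natrD natrM. Qed.

Lemma freq_ge3 j : 3 <= freq j.
Proof. by rewrite freqE lerDr mulr_ge0. Qed.

Lemma freq2_gt0 j : 0 < freq j ^+ 2 - 4.
Proof. by have := freq_ge3 j; nra. Qed.

Lemma tau_gt0 j : 0 < tau j. Proof. by rewrite invr_gt0 freq2_gt0. Qed.

(** The sum telescopes: with m = 2 j + 3, tau j is a quarter of 1 / (m - 2) -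
    1 / (m + 2). *)
Lemma series_tau N : series tau N =
  3^-1 - 4^-1 * ((2 * N%:R + 1)^-1 + (2 * N%:R + 3)^-1).
Proof.
elim: N => [|N IH]; first by rewrite /series/= big_geq// !mulr0 !add0r; lra.
rewrite seriesSr IH /tau freqE -(natr1 N).
have n0 : 0 <= N%:R :> R by [].
move: (N%:R : R) n0 => n n0.
by field; apply/and4P; split; rewrite gt_eqF//; nra.
Qed.

Lemma cvg_series_tau : series tau @ \oo --> (3^-1 : R).
Proof.
have c1 : (fun N => 3^-1 - harmonic N) @ \oo --> (3^-1 : R).
  rewrite -[X in _ --> X]subr0; apply: cvgB; first exact: cvg_cst.
  exact: cvg_harmonic.
have c2 : (fun _ : nat => 3^-1 : R) @ \oo --> (3^-1 : R) by exact: cvg_cst.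
apply: (@squeeze_cvgr _ _ _ _ (fun N => 3^-1 - harmonic N) (fun=> 3^-1)) => //.
apply: nearW => N; rewrite series_tau /harmonic/=.
have n0 : 0 <= N%:R :> R by [].
have h1 : (2 * N%:R + 1)^-1 <= N.+1%:R^-1 :> R.
  by rewrite lef_pV2 ?posrE -?(natr1 N); lra.
have h2 : (2 * N%:R + 3)^-1 <= N.+1%:R^-1 :> R.
  by rewrite lef_pV2 ?posrE -?(natr1 N); lra.
have h3 : 0 <= (2 * N%:R + 1)^-1 :> R by rewrite invr_ge0; lra.
have h4 : 0 <= (2 * N%:R + 3)^-1 :> R by rewrite invr_ge0; lra.
have h5 : 0 <= N.+1%:R^-1 :> R by rewrite invr_ge0.
move: h1 h2 h3 h4 h5; set a := (_ + 1)^-1; set b := (_ + 3)^-1; set c := N.+1%:R^-1.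
move: a b c => a b c *. by apply/andP; split; lra.
Qed.

Lemma is_cvg_series_tau : cvgn (series tau).
Proof. by apply/cvg_ex; exists (3^-1); exact: cvg_series_tau. Qed.

Lemma sumr_tau : sumr tau = 3^-1.
Proof. exact: (cvg_lim _ cvg_series_tau). Qed.

Lemma decay_sqr j : decay j ^+ 2 = (freq j * pi) ^+ 2 - 4 * pi ^+ 2.
Proof. by rewrite /decay exprMn sqr_sqrtr ?(ltW (freq2_gt0 j))//; ring. Qed.

Lemma decay_ge0 j : 0 <= decay j.
Proof. by rewrite mulr_ge0 ?pi_ge0. Qed.

Lemma wavenumber_gt0 j : 0 < freq j * pi.
Proof. by rewrite mulr_gt0 ?pi_gt0//; have := freq_ge3 j; lra. Qed.

Lemma decay_le j : decay j <= freq j * pi.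
Proof.
rewrite -(@ler_pXn2r _ 2) ?nnegrE ?decay_ge0 ?(ltW (wavenumber_gt0 j))// decay_sqr.
by rewrite gerDl oppr_le0 mulr_ge0 ?sqr_ge0.
Qed.

Lemma decay_ge j : freq j * pi / 2 <= decay j.
Proof.
have w0 := wavenumber_gt0 j.
rewrite -(@ler_pXn2r _ 2) ?nnegrE ?decay_ge0 ?divr_ge0 ?(ltW w0)// decay_sqr.
have h : 9 * pi ^+ 2 <= (freq j * pi) ^+ 2.
  rewrite exprMn ler_wpM2r ?sqr_ge0//; have := freq_ge3 j; nra.
have := sqr_ge0 (pi : R); rewrite expr_div_n; lra.
Qed.

Lemma normr_beta j : `|beta j| <= 16 * tau j.
Proof.
have p := pi_ge2 R; have f := freq_ge3 j.
rewrite /beta normrM (ger0_norm (ltW (tau_gt0 j))) ler_wpM2r ?(ltW (tau_gt0 j))//.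
rewrite normrM normrN normfV ger0_norm// ger0_norm; last by rewrite mulr_ge0//; lra.
rewrite ler_pdivrMr; first by rewrite ler_peMr//; nra.
by rewrite mulr_gt0//; lra.
Qed.

End Coefficients.

(** * A Helmholtz solution equal to 1 on the horizontal sides *)

Section ModeSeries.
Context {R : realType}.
Implicit Types (x y : R).

Definition mode (i l j : nat) x y : R :=
  beta j * hyp i (decay j) x * wave l (freq j * pi) 0 y.

Definition modes (i l : nat) x y : R := sumr (fun j => mode i l j x y).

(** At distance d from the vertical sides the exponential decay absorbs every
    power of the frequency produced by differentiation. *)
Lemma mode_bound i l (d : R) : 0 < d -> exists C, 0 <= C /\
  forall j x y, d <= x -> d <= 1 - x -> `|mode i l j x y| <= C * tau j.
Proof.
move=> d0; have [C [C0 HC]] := @exp_decay R (i + l) (d / 2) (divr_gt0 d0 (ltr0n _ 2)).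
exists (32 * C); split; first by rewrite mulr_ge0.
move=> j x y dx dx1; rewrite /mode normrM [X in X * _]normrM.
have w0 := ltW (@wavenumber_gt0 R j); set w := freq j * pi in w0 *.
have k0 := @decay_ge0 R j.
have t0 := ltW (@tau_gt0 R j).
have h1 : `|hyp i (decay j) x| <= 2 * (w ^+ i * expR (- (w * (d / 2)))).
  apply: (le_trans (normr_hyp i k0 dx dx1)).
  rewrite -mulrA ler_pM2l// ler_pM ?exprn_ge0 ?expR_ge0//.
    by rewrite lerXn2r ?nnegrE// decay_le.
  rewrite ler_expR lerN2 (_ : w * (d / 2) = w / 2 * d); last by field.
  by rewrite ler_wpM2r ?decay_ge// ltW.
have h2 : `|wave l w 0 y| <= w ^+ l by exact: normr_wave.
have h3 := @normr_beta R j.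
apply: (@le_trans _ _ (16 * tau j * (2 * (w ^+ i * expR (- (w * (d / 2))))) * w ^+ l)).
  apply: ler_pM; [by rewrite mulr_ge0|exact: normr_ge0| |exact: h2].
  by apply: ler_pM.
have -> : 16 * tau j * (2 * (w ^+ i * expR (- (w * (d / 2))))) * w ^+ l =
  32 * (w ^+ (i + l) * expR (- (w * (d / 2)))) * tau j by rewrite exprD; ring.
by rewrite ler_wpM2r// ler_pM2l// HC.
Qed.

Lemma mode_bound_closed j x y : x \in `[0, 1] -> `|mode 0 0 j x y| <= 16 * tau j.
Proof.
move=> x01; rewrite /mode normrM [X in X * _]normrM.
have t0 := ltW (@tau_gt0 R j).
rewrite -[leRHS]mulr1 ler_pM//; last first.
  by have := normr_wave 0 0 y (ltW (@wavenumber_gt0 R j)); rewrite expr0.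
rewrite -[leRHS]mulr1 ler_pM ?normr_beta//.
by rewrite ger0_norm ?hyp_le1 ?decay_ge0// ltW// hyp_gt0.
Qed.

Lemma cvg_tauZ (C : R) : cvgn (series (fun j => C * tau j)).
Proof. exact: (@is_cvg_seriesZ _ tau C is_cvg_series_tau). Qed.

Lemma strip_margin x : x \in `]0, 1[ -> exists d, [/\ 0 < d, d < x, d < 1 - x &
  forall t : R, t \in `]d, (1 - d)[ -> d <= t /\ d <= 1 - t].
Proof.
rewrite in_itv/= => /andP[x0 x1].
pose d := Num.min (x / 2) ((1 - x) / 2).
have d0 : 0 < d by rewrite lt_min !divr_gt0// subr_gt0.
have : d <= d by [].
rewrite {2}/d le_min => /andP[? ?].
exists d; split; [by []|lra|lra|move=> t].
by rewrite in_itv/= => /andP[? ?]; split; lra.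
Qed.

Lemma cvg_modes i l x y : x \in `]0, 1[ -> cvgn (series (fun j => mode i l j x y)).
Proof.
move=> /strip_margin[d [d0 dx dx1 _]].
have [C [_ HC]] := mode_bound i l d0.
apply: (dominated_cvg_series (@cvg_tauZ C)) => j; by apply: HC; exact: ltW.
Qed.

Lemma is_derive_modes_x i l x y : x \in `]0, 1[ ->
  is_derive x 1 (fun t => modes i l t y) (modes i.+1 l x y).
Proof.
move=> x01; have [d [d0 dx dx1 dsub]] := strip_margin x01.
have [C [_ HC]] := mode_bound i.+1 l d0.
apply: (@is_derive_sumr _ (fun j t => mode i l j t y) (fun j t => mode i.+1 l j t y)
  d (1 - d) x _ (@cvg_tauZ C)).
- by rewrite in_itv/=; apply/andP; split; lra.
- move=> j t _; rewrite /mode.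
  apply: (is_derive_eq (is_derive_mul (is_derive_scale (beta j) (is_derive_hyp i (decay j) t))
    (is_derive_cst (wave l (freq j * pi) 0 y) t 1))).
  by rewrite mulr0 addr0.
- by move=> j t /dsub[? ?]; exact: HC.
- move=> t tI; apply: cvg_modes; move: tI; rewrite !in_itv/= => /andP[? ?].
  by apply/andP; split; lra.
Qed.

Lemma is_derive_modes_y i l x y : x \in `]0, 1[ ->
  is_derive y 1 (fun t => modes i l x t) (modes i l.+1 x y).
Proof.
move=> x01; have [d [d0 dx dx1 dsub]] := strip_margin x01.
have [C [_ HC]] := mode_bound i l.+1 d0.
apply: (@is_derive_sumr _ (fun j t => mode i l j x t) (fun j t => mode i l.+1 j x t)
  (y - 1) (y + 1) y _ (@cvg_tauZ C)).
- by rewrite in_itv/=; apply/andP; split; lra.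
- move=> j t _; rewrite /mode.
  exact: (is_derive_scale (beta j * hyp i (decay j) x) (is_derive_wave l (freq j * pi) 0 t)).
- by move=> j t _; by apply: HC; exact: ltW.
- by move=> t _; exact: cvg_modes.
Qed.

Lemma continuous_hyp i (k : R) : continuous (hyp i k).
Proof. exact: is_derive_continuous (is_derive_hyp i k). Qed.

Lemma continuous_mode i l j : continuous (fun z : R * R => mode i l j z.1 z.2).
Proof.
apply: (@continuous_prod_fun _ (fun x => beta j * hyp i (decay j) x)); last first.
  exact: continuous_wave.
by move=> x; apply: cvgM; [exact: cvg_cst|exact: continuous_hyp].
Qed.

Lemma continuous_modes i l (z : R * R) : z.1 \in `]0, 1[ ->
  {for z, continuous (fun z : R * R => modes i l z.1 z.2)}.
Proof.
move=> x01; have [d [d0 dx dx1 dsub]] := strip_margin x01.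
have [C [_ HC]] := mode_bound i l d0.
apply: (@tannery _ _ _ _ (fun j z => mode i l j z.1 z.2) _ (fun j => C * tau j)).
- exact: cvg_tauZ.
- by move=> j; exact: continuous_mode.
have dz : z.1 \in `]d, (1 - d)[ by rewrite in_itv/=; apply/andP; split; lra.
have cf : fst @ z --> z.1 by exact: cvg_fst.
have : \forall w \near z, w.1 \in `]d, (1 - d)[ by have := cf _ (near_in_itvoo dz).
by apply: filterS => w /dsub[? ?] j; exact: HC.
Qed.

Lemma within_continuous_modes : {within closure square, continuous
  (fun z : R * R => modes 0 0 z.1 z.2)}.
Proof.
apply: (@within_continuous_sumr _ _ _ (fun j z => mode 0 0 j z.1 z.2) (fun j => 16 * tau j)).
- exact: cvg_tauZ.
- by move=> j; apply: continuous_subspaceT; exact: continuous_mode.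
- by move=> j z; rewrite square_closureE => -[? _]; exact: mode_bound_closed.
Qed.

Lemma modes_helmholtz x y : x \in `]0, 1[ ->
  modes 2 0 x y + modes 0 2 x y = - (4 * pi ^+ 2) * modes 0 0 x y.
Proof.
move=> x01; rewrite /modes -sumrD; [|exact: cvg_modes|exact: cvg_modes].
rewrite -sumrZ; last exact: cvg_modes.
congr sumr; apply/funext => j.
by rewrite /mode hyp2 wave2 decay_sqr; ring.
Qed.

End ModeSeries.

Section Solution.
Context {R : realType}.
Implicit Types (x y : R).

Definition base_rate : R := Num.sqrt 3 * pi.
(** The i-th derivative of the profile of frequency 1, which is cos (base_rate
    (x - 1/2)) / cos (base_rate / 2). *)
Definition base (i : nat) x : R := wave i base_rate (pi / 2 - base_rate / 2) x / cos (base_rate / 2).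

Lemma baseE x : base 0 x = cos (base_rate * (x - 1 / 2)) / cos (base_rate / 2).
Proof.
rewrite /base /wave expr0 mul1r mul0r addr0 -[cos (base_rate * (x - 1 / 2))]sinDpihalf.
by have -> : base_rate * x + (pi / 2 - base_rate / 2) = base_rate * (x - 1 / 2) + pi / 2 by field.
Qed.

Lemma is_derive_base i x : is_derive x 1 (base i) (base i.+1 x).
Proof.
apply: (is_derive_eq (is_derive_mul (is_derive_wave i base_rate _ x)
  (is_derive_cst (cos (base_rate / 2))^-1 x 1))).
by rewrite mulr0 addr0.
Qed.

Lemma base_rate_sqr : base_rate ^+ 2 = 3 * pi ^+ 2.
Proof. by rewrite /base_rate exprMn sqr_sqrtr ?ler0n. Qed.

Lemma base2 i x : base i.+2 x = - (3 * pi ^+ 2) * base i x.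
Proof. by rewrite /base wave2 base_rate_sqr -mulrA. Qed.

(** The coefficient of sin (pi y) in 1 - cos (2 pi y). *)
Definition beta1 : R := 16 / (3 * pi).

(** The derivative of order i in x and l in y of cos (2 pi y) + beta1 sin (pi
    y) base (x) + sum_j beta j sin (freq j pi y) hyp (x), for 0 < x < 1. *)
Definition sol (i l : nat) x y : R :=
  (if i is 0%N then wave l (2 * pi) (pi / 2) y else 0) +
  beta1 * base i x * wave l pi 0 y + modes i l x y.

Lemma is_derive_sol_x i l x y : x \in `]0, 1[ ->
  is_derive x 1 (fun t => sol i l t y) (sol i.+1 l x y).
Proof.
move=> x01.
have h0 : is_derive x 1 (fun _ : R => if i is 0%N then wave l (2 * pi) (pi / 2) y else 0) 0.
  exact: is_derive_cst.
have h1 := is_derive_mul (is_derive_scale beta1 (is_derive_base i x))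
  (is_derive_cst (wave l pi 0 y) x 1).
apply: (is_derive_eq (is_derive_add (is_derive_add h0 h1) (is_derive_modes_x i l y x01))).
by rewrite mulr0 addr0.
Qed.

Lemma is_derive_sol_y i l x y : x \in `]0, 1[ ->
  is_derive y 1 (fun t => sol i l x t) (sol i l.+1 x y).
Proof.
move=> x01.
have h0 : is_derive y 1 (fun t : R => if i is 0%N then wave l (2 * pi) (pi / 2) t else 0)
    (if i is 0%N then wave l.+1 (2 * pi) (pi / 2) y else 0).
  by case: i => [|i]; [exact: is_derive_wave|exact: is_derive_cst].
have h1 := is_derive_scale (beta1 * base i x) (is_derive_wave l pi 0 y).
exact: (is_derive_add (is_derive_add h0 h1) (is_derive_modes_y i l y x01)).
Qed.

Lemma continuous_sol_explicit i l : continuous (fun z : R * R =>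
  (if i is 0%N then wave l (2 * pi) (pi / 2) z.2 else 0) +
  beta1 * base i z.1 * wave l pi 0 z.2).
Proof.
move=> z; apply: cvgD.
  case: i => [|i]; last exact: cvg_cst.
  apply: (@continuous_comp _ _ _ snd (wave l (2 * pi) (pi / 2))); first exact: cvg_snd.
  exact: continuous_wave.
apply: (@continuous_prod_fun _ (fun x => beta1 * base i x)); last exact: continuous_wave.
move=> x; apply: cvgM; first exact: cvg_cst.
exact: (is_derive_continuous (is_derive_base i)).
Qed.

Lemma continuous_sol i l (z : R * R) : z.1 \in `]0, 1[ ->
  {for z, continuous (fun z : R * R => sol i l z.1 z.2)}.
Proof.
move=> x01; apply: cvgD; first exact: continuous_sol_explicit.
exact: continuous_modes.
Qed.

Lemma within_continuous_sol : {within closure square, continuous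
  (fun z : R * R => sol 0 0 z.1 z.2)}.
Proof.
have c1 := continuous_subspaceT (A := closure square) (@continuous_sol_explicit 0 0).
by move=> z; apply: cvgD; [exact: c1|exact: within_continuous_modes].
Qed.

Lemma sol_helmholtz x y : x \in `]0, 1[ ->
  sol 2 0 x y + sol 0 2 x y = - (4 * pi ^+ 2) * sol 0 0 x y.
Proof.
move=> x01; have := modes_helmholtz y x01.
rewrite /sol base2 !wave2 => h.
have -> : modes 2 0 x y = - (4 * pi ^+ 2) * modes 0 0 x y - modes 0 2 x y by lra.
by ring.
Qed.

Lemma sol_boundary x y : y = 0 \/ y = 1 -> sol 0 0 x y = 1.
Proof.
move=> y01.
have s0 n : sin (n%:R * pi * y) = 0 :> R.
  by case: y01 => ->; rewrite ?mulr0 ?mulr1 ?sin0 ?sin_natpi.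
rewrite /sol wave0 -[pi * y]mul1r mulrA -[1]/(1%:R) s0 mulr0 addr0.
rewrite /modes sumr0 ?addr0; last by move=> j; rewrite /mode wave0 s0 mulr0.
rewrite /wave expr0 mul1r mul0r addr0 sinDpihalf.
case: y01 => ->; first by rewrite mulr0 cos0.
by rewrite mulr1 mulr_natl cos2pi.
Qed.

End Solution.

(** * Symmetry of the solution under exchange of the coordinates *)

Section Symmetry.
Context {R : realType}.
Implicit Types (x y : R) (n k : nat).

Lemma sqrt3_bounds : 5 / 3 < Num.sqrt (3 : R) < 2.
Proof.
have s0 : 0 <= Num.sqrt 3 :> R by exact: sqrtr_ge0.
have s2 : Num.sqrt 3 ^+ 2 = 3 :> R by rewrite sqr_sqrtr ?ler0n.
by apply/andP; split; nra.
Qed.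

Lemma cos_base_rate_lt0 : cos (base_rate / 2) < 0 :> R.
Proof.
have p0 := pi_gt0 R; have /andP[s1 s2] := sqrt3_bounds.
have -> : base_rate / 2 = (Num.sqrt 3 - 1) * pi / 2 + pi / 2 :> R by rewrite /base_rate; field.
rewrite cosDpihalf oppr_lt0; apply: sin_gt0_pihalf.
by apply/andP; split; nra.
Qed.

Lemma base00 : base 0 0 = 1 :> R.
Proof.
rewrite baseE (_ : base_rate * (0 - 1 / 2) = - (base_rate / 2)); last by field.
by rewrite cosN divff// lt_eqF// cos_base_rate_lt0.
Qed.

Lemma base01 : base 0 1 = 1 :> R.
Proof.
rewrite baseE (_ : base_rate * (1 - 1 / 2) = base_rate / 2); last by field.
by rewrite divff// lt_eqF// cos_base_rate_lt0.
Qed.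

Lemma C01_hyp i (k : R) : C01 (hyp i k).
Proof. by apply: C01_continuous; exact: continuous_hyp. Qed.

Lemma C01_base i : C01 (@base R i).
Proof. by apply: C01_continuous; exact: is_derive_continuous (is_derive_base i). Qed.

(** This is 1 - cos (n pi), the boundary term of Green's formula for a profile
    equal to 1 at both ends. *)
Definition odd_par n : R := 1 - (-1) ^+ n.
Definition sine1 n : R := odd_par n / (n%:R * pi).
Definition sine_cos2 n : R := n%:R * odd_par n / (pi * (n%:R ^+ 2 - 4)).
Definition sine_base n : R := n%:R * odd_par n / (pi * (n%:R ^+ 2 - 3)).
Definition sine_hyp j n : R := n%:R * odd_par n / (pi * (freq j ^+ 2 + n%:R ^+ 2 - 4)).

(** All sine integrals of the profiles in x are instances of this identity. *)
Lemma green_const_ends (p p1 : R -> R) (c : R) n : C01 p -> C01 p1 ->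
  (forall x : R, x \in `]0, 1[ -> is_derive x 1 p (p1 x)) ->
  (forall x : R, x \in `]0, 1[ -> is_derive x 1 p1 (c * p x)) -> p 0 = 1 -> p 1 = 1 ->
  (c + (n%:R * pi) ^+ 2) * I01 (fun x => p x * sin (n%:R * pi * x)) = n%:R * pi * odd_par n.
Proof.
move=> cp cp1 dp dp1 p00 p11.
have cq : C01 (fun x => c * p x) by apply: C01M => //; exact: C01_cst.
have := green_sin cp cp1 cq dp dp1 (sin_natpi n).
rewrite p00 p11 mul1r cos_natpi -/(odd_par n) => <-.
rewrite mulrDl; congr (_ + _).
under [RHS]eq_I01 do rewrite -mulrA.
by rewrite I01Z//; apply: C01M => //; exact: C01_sinM.
Qed.

Lemma I01_sin n : (0 < n)%N -> I01 (fun x : R => sin (n%:R * pi * x)) = sine1 n.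
Proof.
move=> n0; have a0 : n%:R * pi != 0 :> R by rewrite mulf_neq0 ?gt_eqF ?pi_gt0// ltr0n.
have d1 (x : R) : x \in `]0, 1[ -> is_derive x 1 (fun _ : R => 1 : R) 0.
  by move=> _; exact: is_derive_cst.
have d2 (x : R) : x \in `]0, 1[ -> is_derive x 1 (fun _ : R => 0 : R) (0 * 1).
  by move=> _; rewrite mul0r; exact: is_derive_cst.
have h := green_const_ends n (@C01_cst R 1) (@C01_cst R 0) d1 d2 erefl erefl.
have E : I01 (fun x : R => 1 * sin (n%:R * pi * x)) = I01 (fun x : R => sin (n%:R * pi * x)).
  by apply: eq_I01 => x _; rewrite mul1r.
rewrite add0r E in h; rewrite /sine1; apply: (mulfI (expf_neq0 2 a0)); rewrite h.
by move: (n%:R * pi) a0 => a a0; field.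
Qed.

Lemma I01_cos2_sin n : (0 < n)%N ->
  I01 (fun x : R => cos (2%:R * pi * x) * sin (n%:R * pi * x)) = sine_cos2 n.
Proof.
have p0 : pi != 0 :> R by rewrite gt_eqF ?pi_gt0.
move=> n0; have n0' : n%:R != 0 :> R by rewrite pnatr_eq0 -lt0n.
(* At n = 2 both factors have the same eigenvalue, and Green's formula is void. *)
have [->|n2] := eqVneq n 2%N.
  rewrite /sine_cos2 /odd_par sqrrN expr1n subrr mulr0 mul0r.
  rewrite (@eq_I01 _ _ (fun x => 1 / 2 * sin (4%:R * pi * x))); last first.
    move=> x _; rewrite (_ : 4%:R * pi * x = (2%:R * pi * x) *+ 2).
      by rewrite sin_mulr2n -mulr_natr; field.
    by rewrite -mulr_natr; ring.
  rewrite I01Z ?I01_sin//; last exact: C01_sinM.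
  by rewrite /sine1 /odd_par -signr_odd expr0 subrr mul0r mulr0.
have c1 : C01 (fun x : R => - (2%:R * pi * sin (2%:R * pi * x))).
  by apply: C01N; apply: C01M; [exact: C01_cst|exact: C01_sinM].
have := @green_const_ends _ _ (- (2%:R * pi) ^+ 2) n (@C01_cosM R (2%:R * pi)) c1.
move=> /(_ _ _ _ _)/wrap[x _|x _|||h].
- exact: is_derive_cosM.
- apply: (is_derive_eq (is_derive_opp (is_derive_scale (2%:R * pi) (is_derive_sinM _ x)))).
  by ring.
- by rewrite mulr0 cos0.
- by rewrite mulr1 mulr_natl cos2pi.
have n4 : n%:R ^+ 2 - 4 != 0 :> R.
  rewrite (_ : _ - 4 = (n%:R - 2) * (n%:R + 2)); last by ring.
  by rewrite mulf_neq0// ?subr_eq0 ?(eqr_nat R n 2)// gt_eqF// ltr_wpDl.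
have k0 : - (2%:R * pi) ^+ 2 + (n%:R * pi) ^+ 2 != 0 :> R.
  rewrite (_ : _ + _ = pi ^+ 2 * (n%:R ^+ 2 - 4)); last by ring.
  by rewrite mulf_neq0// expf_neq0.
apply: (mulfI k0); rewrite h /sine_cos2; move: (pi : R) p0 => P P0; field.
by rewrite P0 n4.
Qed.

Lemma I01_base_sin n : (0 < n)%N ->
  I01 (fun x : R => base 0 x * sin (n%:R * pi * x)) = sine_base n.
Proof.
move=> n0.
have := @green_const_ends (base 0) (base 1) (- (3 * pi ^+ 2)) n (@C01_base 0) (@C01_base 1).
move=> /(_ _ _ base00 base01)/wrap[x _|x _|h].
- exact: is_derive_base.
- by rewrite -base2; exact: is_derive_base.
have p0 : pi != 0 :> R by rewrite gt_eqF ?pi_gt0.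
have n3 : n%:R ^+ 2 - 3 != 0 :> R.
  rewrite subr_eq0 -natrX eqr_nat; case: n n0 {h} => [|[|n]]// _.
  by rewrite gtn_eqF// (@leq_trans (2 ^ 2))// leq_exp2r.
have k0 : - (3 * pi ^+ 2) + (n%:R * pi) ^+ 2 != 0 :> R.
  rewrite (_ : _ + _ = pi ^+ 2 * (n%:R ^+ 2 - 3)); last by ring.
  by rewrite mulf_neq0// expf_neq0.
apply: (mulfI k0); rewrite h /sine_base; move: (pi : R) p0 => P P0; field.
by rewrite P0 n3.
Qed.

Lemma I01_hyp_sin j n : (0 < n)%N ->
  I01 (fun x : R => hyp 0 (decay j) x * sin (n%:R * pi * x)) = sine_hyp j n.
Proof.
move=> n0.
have := @green_const_ends (hyp 0 (decay j)) (hyp 1 (decay j)) (decay j ^+ 2) n (@C01_hyp 0 _) (@C01_hyp 1 _).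
move=> /(_ _ _ (hyp00 _) (hyp01 _))/wrap[x _|x _|h].
- exact: is_derive_hyp.
- by rewrite -hyp2; exact: is_derive_hyp.
have p0 : pi != 0 :> R by rewrite gt_eqF ?pi_gt0.
have n4 : freq j ^+ 2 + n%:R ^+ 2 - 4 != 0 :> R.
  by rewrite addrAC gt_eqF// ltr_wpDr ?sqr_ge0// freq2_gt0.
have k0 : decay j ^+ 2 + (n%:R * pi) ^+ 2 != 0 :> R.
  rewrite decay_sqr (_ : _ + _ = pi ^+ 2 * (freq j ^+ 2 + n%:R ^+ 2 - 4)); last by ring.
  by rewrite mulf_neq0// expf_neq0.
apply: (mulfI k0); rewrite h /sine_hyp decay_sqr; move: (pi : R) (freq j) p0 n4 => P F P0 F0; field.
by rewrite P0 F0.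
Qed.

(** The part of the solution outside the series; the factor 1%:R puts its sine
    in the form of the sine system. *)
Definition explicit_part x y : R := cos (2%:R * pi * y) + beta1 * base 0 x * sin (1%:R * pi * y).

Lemma sol_seriesE x y : sol 0 0 x y = explicit_part x y +
  sumr (fun j => beta j * hyp 0 (decay j) x * sin ((2 * j + 3)%N%:R * pi * y)).
Proof.
rewrite /sol /explicit_part wave0 mul1r /modes; congr (_ + _ + _).
  by rewrite /wave expr0 mul1r mul0r addr0 sinDpihalf.
by congr sumr; apply/funext => j; rewrite /mode wave0.
Qed.

Lemma normr_hyp0 j x : x \in `[0, 1] -> `|hyp 0 (decay j) x| <= 1 :> R.
Proof. by move=> x01; rewrite ger0_norm ?hyp_le1 ?decay_ge0// ltW// hyp_gt0. Qed.

Lemma normr_half_delta m n : `|half_delta m n| <= 1 :> R.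
Proof. by rewrite /half_delta; case: ifP => _; rewrite ?normr0// ger0_norm; lra. Qed.

Lemma beta_dominated (u : nat -> R) : (forall j, `|u j| <= 1) ->
  forall j, `|beta j * u j| <= 16 * tau j.
Proof.
move=> u1 j; rewrite normrM -[leRHS]mulr1.
by apply: ler_pM => //; exact: normr_beta.
Qed.

Lemma normr_mul_le1 (a b : R) : `|a| <= 1 -> `|b| <= 1 -> `|a * b| <= 1.
Proof. by move=> ha hb; rewrite normrM mulr_ile1. Qed.

Lemma I01_beta_sumr (u : nat -> R -> R) : (forall j, C01 (u j)) ->
  (forall j x, x \in `[0, 1] -> `|u j x| <= 1) ->
  I01 (fun x => sumr (fun j => beta j * u j x)) = sumr (fun j => beta j * I01 (u j)).
Proof.
move=> cu u1; rewrite (@I01_sumr _ (fun j x => beta j * u j x) (fun j => 16 * tau j)).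
- by congr sumr; apply/funext => j; rewrite I01Z.
- exact: cvg_tauZ.
- by move=> j; apply: C01M => //; exact: C01_cst.
- by move=> j x x01; apply: (@beta_dominated (u ^~ x)) => i; exact: u1.
Qed.

Lemma cvg_beta (u : nat -> R) : (forall j, `|u j| <= 1) ->
  cvgn (series (fun j => beta j * u j)).
Proof.
move=> u1; apply: (dominated_cvg_series (@cvg_tauZ R 16)).
exact: beta_dominated.
Qed.

Lemma C01_beta_sumr (u : nat -> R -> R) : (forall j, C01 (u j)) ->
  (forall j x, x \in `[0, 1] -> `|u j x| <= 1) ->
  C01 (fun x => sumr (fun j => beta j * u j x)).
Proof.
move=> cu u1.
apply: (@within_continuous_sumr _ _ _ (fun j x => beta j * u j x) (fun j => 16 * tau j)).
- exact: cvg_tauZ.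
- by move=> j; apply: C01M => //; exact: C01_cst.
- by move=> j x x01; apply: (@beta_dominated (u ^~ x)) => i; exact: u1.
Qed.

(** The terms are dominated by 16 tau, so the series can be integrated term by
    term. *)
Lemma I01_beta_sumr_sin (u : nat -> R -> R) n : (forall j, C01 (u j)) ->
  (forall j x, x \in `[0, 1] -> `|u j x| <= 1) ->
  I01 (fun x => sumr (fun j => beta j * u j x) * sin (n%:R * pi * x)) =
  sumr (fun j => beta j * I01 (fun x => u j x * sin (n%:R * pi * x))).
Proof.
move=> cu u1.
rewrite -(@I01_beta_sumr (fun j x => u j x * sin (n%:R * pi * x))).
- apply: eq_I01 => x x01; rewrite -sumrZr; last by apply: cvg_beta => j; exact: u1.
  by congr sumr; apply/funext => j; rewrite mulrA.
- by move=> j; apply: C01M => //; exact: C01_sinM.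
- by move=> j x x01; apply: normr_mul_le1; [exact: u1|exact: sin_max].
Qed.

Lemma sine_coef_explicit x n : (0 < n)%N ->
  I01 (fun y => explicit_part x y * sin (n%:R * pi * y)) =
  sine_cos2 n + beta1 * base 0 x * half_delta 1 n.
Proof.
move=> n0; have c1 m : C01 (fun y : R => sin (m%:R * pi * y)) by exact: C01_sinM.
rewrite (@eq_I01 _ _ (fun y => cos (2%:R * pi * y) * sin (n%:R * pi * y) +
  beta1 * base 0 x * (sin (1%:R * pi * y) * sin (n%:R * pi * y)))); last first.
  by move=> y _; rewrite /explicit_part; ring.
rewrite I01D; first last.
- by apply: C01M; [exact: C01_cst|exact: C01M].
- by apply: C01M => //; exact: C01_cosM.
by rewrite I01Z ?I01_cos2_sin ?sin_orthogonal//; exact: C01M.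
Qed.

Lemma C01_explicit_part x : C01 (explicit_part x).
Proof.
apply: C01D; first exact: C01_cosM.
by apply: C01M; [exact: C01_cst|exact: C01_sinM].
Qed.

Lemma sine_coef_snd x n : x \in `[0, 1] -> (0 < n)%N ->
  I01 (fun y => sol 0 0 x y * sin (n%:R * pi * y)) =
  sine_cos2 n + beta1 * base 0 x * half_delta 1 n +
  sumr (fun j => beta j * (hyp 0 (decay j) x * half_delta (2 * j + 3)%N n)).
Proof.
move=> x01 n0.
pose u j (y : R) := hyp 0 (decay j) x * sin ((2 * j + 3)%N%:R * pi * y).
have cu j : C01 (u j) by apply: C01M; [exact: C01_cst|exact: C01_sinM].
have u1 j y : y \in `[0, 1] -> `|u j y| <= 1.
  by move=> _; apply: normr_mul_le1; [exact: normr_hyp0|exact: sin_max].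
have cs : C01 (fun y : R => sin (n%:R * pi * y)) by exact: C01_sinM.
rewrite (@eq_I01 _ _ (fun y => explicit_part x y * sin (n%:R * pi * y) +
  sumr (fun j => beta j * u j y) * sin (n%:R * pi * y))); last first.
  move=> y _; rewrite sol_seriesE mulrDl; congr (_ + _ * _).
  by congr sumr; apply/funext => j; rewrite /u mulrA.
rewrite I01D; [|by apply: C01M => //; exact: C01_explicit_part|
  by apply: C01M => //; exact: C01_beta_sumr].
rewrite sine_coef_explicit// I01_beta_sumr_sin//; congr (_ + _).
congr sumr; apply/funext => j; congr (_ * _).
rewrite (@eq_I01 _ _ (fun y => hyp 0 (decay j) x *
  (sin ((2 * j + 3)%N%:R * pi * y) * sin (n%:R * pi * y)))); last first.
  by move=> y _; rewrite /u mulrA.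
rewrite I01Z; last by apply: C01M => //; exact: C01_sinM.
by rewrite sin_orthogonal// addn3.
Qed.

(** The sine coefficient of the solution of index n in y and k in x. With the
    two coordinates of the solution exchanged, the same coefficient comes out
    as double_coef k n. *)
Definition double_coef n k : R := sine_cos2 n * sine1 k + beta1 * sine_base k * half_delta 1 n +
  sumr (fun j => beta j * (sine_hyp j k * half_delta (2 * j + 3)%N n)).

Lemma double_coef_snd n k : (0 < n)%N -> (0 < k)%N ->
  I01 (fun x => (sine_cos2 n + beta1 * base 0 x * half_delta 1 n +
  sumr (fun j => beta j * (hyp 0 (decay j) x * half_delta (2 * j + 3)%N n))) *
    sin (k%:R * pi * x)) = double_coef n k.
Proof.
move=> n0 k0.
have cs : C01 (fun y : R => sin (k%:R * pi * y)) by exact: C01_sinM.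
pose u j (x : R) := hyp 0 (decay j) x * half_delta (2 * j + 3)%N n.
have cu j : C01 (u j) by apply: C01M; [exact: C01_hyp|exact: C01_cst].
have u1 j x : x \in `[0, 1] -> `|u j x| <= 1.
  by move=> x01; apply: normr_mul_le1; [exact: normr_hyp0|exact: normr_half_delta].
rewrite (@eq_I01 _ _ (fun x => sine_cos2 n * sin (k%:R * pi * x) +
   beta1 * half_delta 1 n * (base 0 x * sin (k%:R * pi * x)) +
   sumr (fun j => beta j * u j x) * sin (k%:R * pi * x))); last first.
  by move=> x _; rewrite !mulrDl; congr (_ + _ + _); ring.
have cb : C01 (fun x => base 0 x * sin (k%:R * pi * x)).
  by apply: C01M => //; exact: C01_base.
have c1 : C01 (fun x => sine_cos2 n * sin (k%:R * pi * x)).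
  by apply: C01M => //; exact: C01_cst.
have c2 : C01 (fun x => beta1 * half_delta 1 n * (base 0 x * sin (k%:R * pi * x))).
  by apply: C01M => //; exact: C01_cst.
rewrite I01D; [|exact: C01D|by apply: C01M => //; exact: C01_beta_sumr].
rewrite I01D// !I01Z// I01_sin// I01_base_sin// I01_beta_sumr_sin// /double_coef.
congr (_ + _ + _); first by ring.
congr sumr; apply/funext => j; congr (_ * _).
rewrite (@eq_I01 _ _ (fun x => half_delta (2 * j + 3)%N n *
  (hyp 0 (decay j) x * sin (k%:R * pi * x)))); last first.
  by move=> x _; rewrite /u; ring.
rewrite I01Z; last by apply: C01M => //; exact: C01_hyp.
by rewrite I01_hyp_sin// mulrC.
Qed.

Lemma normr_sine_hyp j n : (0 < n)%N -> `|sine_hyp j n| <= 1.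
Proof.
move=> n0; rewrite -I01_hyp_sin//; apply: normr_I01.
  by apply: C01M; [exact: C01_hyp|exact: C01_sinM].
by move=> x x01; apply: normr_mul_le1; [exact: normr_hyp0|exact: sin_max].
Qed.

Lemma sine_coef_fst x n : x \in `[0, 1] -> (0 < n)%N ->
  I01 (fun y => sol 0 0 y x * sin (n%:R * pi * y)) =
  cos (2%:R * pi * x) * sine1 n + beta1 * sine_base n * sin (1%:R * pi * x) +
  sumr (fun j => beta j * (sine_hyp j n * sin ((2 * j + 3)%N%:R * pi * x))).
Proof.
move=> x01 n0.
have cs : C01 (fun y : R => sin (n%:R * pi * y)) by exact: C01_sinM.
pose u j (y : R) := hyp 0 (decay j) y * sin ((2 * j + 3)%N%:R * pi * x).
have cu j : C01 (u j) by apply: C01M; [exact: C01_hyp|exact: C01_cst].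
have u1 j y : y \in `[0, 1] -> `|u j y| <= 1.
  by move=> y01; apply: normr_mul_le1; [exact: normr_hyp0|exact: sin_max].
rewrite (@eq_I01 _ _ (fun y => cos (2%:R * pi * x) * sin (n%:R * pi * y) +
   beta1 * sin (1%:R * pi * x) * (base 0 y * sin (n%:R * pi * y)) +
   sumr (fun j => beta j * u j y) * sin (n%:R * pi * y))); last first.
  move=> y _; rewrite sol_seriesE mulrDl; congr (_ + _ * _).
    by rewrite /explicit_part; ring.
  by congr sumr; apply/funext => j; rewrite /u mulrA.
have cb : C01 (fun x => base 0 x * sin (n%:R * pi * x)).
  by apply: C01M => //; exact: C01_base.
have c1 : C01 (fun y => cos (2%:R * pi * x) * sin (n%:R * pi * y)).
  by apply: C01M => //; exact: C01_cst.
have c2 : C01 (fun y => beta1 * sin (1%:R * pi * x) * (base 0 y * sin (n%:R * pi * y))).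
  by apply: C01M => //; exact: C01_cst.
rewrite I01D; [|exact: C01D|by apply: C01M => //; exact: C01_beta_sumr].
rewrite I01D// !I01Z// I01_sin// I01_base_sin// I01_beta_sumr_sin//.
congr (_ + _ + _); first by ring.
congr sumr; apply/funext => j; congr (_ * _).
rewrite (@eq_I01 _ _ (fun y => sin ((2 * j + 3)%N%:R * pi * x) *
  (hyp 0 (decay j) y * sin (n%:R * pi * y)))); last first.
  by move=> y _; rewrite /u; ring.
rewrite I01Z; last by apply: C01M => //; exact: C01_hyp.
by rewrite I01_hyp_sin// mulrC.
Qed.

Lemma double_coef_fst n k : (0 < n)%N -> (0 < k)%N ->
  I01 (fun x => (cos (2%:R * pi * x) * sine1 n + beta1 * sine_base n * sin (1%:R * pi * x) +
  sumr (fun j => beta j * (sine_hyp j n * sin ((2 * j + 3)%N%:R * pi * x)))) *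
    sin (k%:R * pi * x)) = double_coef k n.
Proof.
move=> n0 k0.
have cs m : C01 (fun y : R => sin (m%:R * pi * y)) by exact: C01_sinM.
pose u j (x : R) := sine_hyp j n * sin ((2 * j + 3)%N%:R * pi * x).
have cu j : C01 (u j) by apply: C01M => //; exact: C01_cst.
have u1 j x : x \in `[0, 1] -> `|u j x| <= 1.
  by move=> x01; apply: normr_mul_le1; [exact: normr_sine_hyp|exact: sin_max].
rewrite (@eq_I01 _ _ (fun x => sine1 n * (cos (2%:R * pi * x) * sin (k%:R * pi * x)) +
   beta1 * sine_base n * (sin (1%:R * pi * x) * sin (k%:R * pi * x)) +
   sumr (fun j => beta j * u j x) * sin (k%:R * pi * x))); last first.
  by move=> x _; rewrite !mulrDl; congr (_ + _ + _); ring.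
have cc : C01 (fun x : R => cos (2%:R * pi * x) * sin (k%:R * pi * x)).
  by apply: C01M => //; exact: C01_cosM.
have cb : C01 (fun x : R => sin (1%:R * pi * x) * sin (k%:R * pi * x)) by exact: C01M.
have c1 : C01 (fun x : R => sine1 n * (cos (2%:R * pi * x) * sin (k%:R * pi * x))).
  by apply: C01M => //; exact: C01_cst.
have c2 : C01 (fun x : R => beta1 * sine_base n * (sin (1%:R * pi * x) * sin (k%:R * pi * x))).
  by apply: C01M => //; exact: C01_cst.
rewrite I01D; [|exact: C01D|by apply: C01M => //; exact: C01_beta_sumr].
rewrite I01D// !I01Z// I01_cos2_sin// sin_orthogonal// I01_beta_sumr_sin// /double_coef.
congr (_ + _ + _); first by ring.
congr sumr; apply/funext => j; congr (_ * _).
rewrite (@eq_I01 _ _ (fun x => sine_hyp j n *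
  (sin ((2 * j + 3)%N%:R * pi * x) * sin (k%:R * pi * x)))); last first.
  by move=> x _; rewrite /u; ring.
rewrite I01Z; last exact: C01M.
by rewrite sin_orthogonal// addn3.
Qed.

(** Only the mode of frequency n contributes besides cos (2 pi y). The
    symmetric closed form comes from the factorization n^2 (n^2 + k^2 - 4) - 4
    k^2 = (n^2 - 4) (n^2 + k^2). *)
Lemma double_coefE n k : (0 < n)%N -> (0 < k)%N -> double_coef n k =
  odd_par n * odd_par k * (n%:R ^+ 2 + k%:R ^+ 2) / (pi ^+ 2 * n%:R * k%:R * (n%:R ^+ 2 + k%:R ^+ 2 - 4)).
Proof.
move=> n0 k0; have odd_parE m : odd_par m = if odd m then 2 else 0 :> R.
  by rewrite /odd_par -signr_odd; case: odd; rewrite ?expr1 ?expr0 ?subrr// opprK.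
have half0 (m : nat) : m != n -> half_delta m n = 0 :> R by rewrite /half_delta => /negbTE->.
have p0 : pi != 0 :> R by rewrite gt_eqF ?pi_gt0.
have k0' : k%:R != 0 :> R by rewrite pnatr_eq0 -lt0n.
have [ok|ek] := boolP (odd k); last first.
  rewrite /double_coef /sine1 /sine_base /sine_hyp (odd_parE k) (negbTE ek).
  by rewrite sumr0 => [|j]; rewrite !(mulr0, mul0r, addr0).
have k3 : k%:R ^+ 2 - 3 != 0 :> R.
  rewrite subr_eq0 -natrX eqr_nat; case: k k0 {ok k0'} => [|[|m]]// _.
  by rewrite gtn_eqF// (@leq_trans (2 ^ 2))// leq_exp2r.
have [n1|n1] := eqVneq n 1%N.
  rewrite /double_coef sumr0 => [|j]; last by rewrite half0 ?mulr0// n1 addn3.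
  rewrite addr0 /half_delta n1 eqxx /sine_cos2 /sine1 /sine_base /beta1 !odd_parE ok/=.
  move: (pi : R) p0 (k%:R : R) k0' k3 => P P0 K K0 K3; field.
  by rewrite P0 K0 (_ : 1 + K ^+ 2 - 4 = K ^+ 2 - 3) ?K3//; ring.
have [on|en] := boolP (odd n); last first.
  rewrite /double_coef /sine_cos2 (odd_parE n) (negbTE en) half0; last by rewrite eq_sym.
  rewrite sumr0 => [|j]; first by rewrite !(mulr0, mul0r, addr0).
  rewrite half0 ?mulr0//; apply: contraNneq en => <-.
  by rewrite oddD oddM.
have [i ni] : exists i, n = (2 * i + 3)%N.
  exists ((n - 3)./2); rewrite mul2n halfK oddB; last by case: n on n1 {n0 half0} => [|[|[|]]].
  rewrite on/= subn0 subnK//; by case: n on n1 {n0 half0} => [|[|[|]]].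
have fi : freq i = n%:R :> R by rewrite ni.
rewrite /double_coef half0; last by rewrite eq_sym.
rewrite (@sumr_single _ _ i) => [|j ji]; last first.
  rewrite half0 ?mulr0// ni eqn_add2r eqn_pmul2l//.
rewrite mulr0 addr0 {1}/half_delta -ni eqxx /sine_hyp /beta /tau fi /sine_cos2 /sine1 !odd_parE on ok.
have n4 : n%:R ^+ 2 - 4 != 0 :> R by rewrite -fi gt_eqF// freq2_gt0.
have nk4 : n%:R ^+ 2 + k%:R ^+ 2 - 4 != 0 :> R.
  by rewrite addrAC gt_eqF// ltr_wpDr ?sqr_ge0// -fi freq2_gt0.
have n0' : n%:R != 0 :> R by rewrite pnatr_eq0 -lt0n.
move: (pi : R) p0 (k%:R : R) k0' {k3} (n%:R : R) n0' n4 nk4 {fi} => P P0 K K0 N N0 N4 NK4.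
by field; rewrite P0 K0 N0 N4 NK4.
Qed.

Lemma double_coef_sym n k : (0 < n)%N -> (0 < k)%N -> double_coef n k = double_coef k n.
Proof.
move=> n0 k0; rewrite !double_coefE// (mulrC (odd_par n)) (addrC (k%:R ^+ 2)).
by rewrite (mulrAC (pi ^+ 2) k%:R).
Qed.

(** Let u be the difference of the two sides. The sine coefficients of u in y
    are continuous functions of x whose own sine coefficients vanish by
    double_coef_sym. So they vanish by completeness in x, and u vanishes by
    completeness in y. *)
Lemma sol_sym x y : x \in `[0, 1] -> y \in `[0, 1] -> sol 0 0 x y = sol 0 0 y x.
Proof.
pose u (z : R * R) := sol 0 0 z.1 z.2 + - sol 0 0 z.2 z.1.
have cu : {within closure square, continuous u}.
  move=> z; apply: cvgB; first exact: within_continuous_sol.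
  apply: (within_continuous_comp_sub (A := closure square) (phi := fun z : R * R => (z.2, z.1))
    _ _ within_continuous_sol).
    by move=> [a b]; rewrite square_closureE => -[].
  by apply: continuous_subspaceT => w; exact: (cvg_pair cvg_snd cvg_fst).
have cj (a : R) : a \in `[0, 1] -> C01 (fun b => sol 0 0 a b).
  by move=> a01; exact: (C01_slice_closed within_continuous_sol a01).
have cj' (a : R) : a \in `[0, 1] -> C01 (fun b => sol 0 0 b a).
  move=> a01; apply: (within_continuous_comp_sub (phi := fun b => (b, a))
    (B := closure square) (h := fun z : R * R => sol 0 0 z.1 z.2)).
  - by move=> b b01; rewrite square_closureE.
  - by apply: continuous_subspaceT => b; exact: (cvg_pair cvg_id (cvg_cst a)).
  - exact: within_continuous_sol.
have cs n : C01 (fun y : R => sin (n%:R * pi * y)) by exact: C01_sinM.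
have D0 n (a : R) : a \in `[0, 1] -> I01 (fun b => u (a, b) * sin (n.+1%:R * pi * b)) = 0.
  move: a; apply: sine_complete; first exact: C01_I01_slice.
  move=> k.
  rewrite (@eq_I01 _ _ (fun a => (sine_cos2 n.+1 + beta1 * base 0 a * half_delta 1 n.+1 +
    sumr (fun j => beta j * (hyp 0 (decay j) a * half_delta (2 * j + 3)%N n.+1))) *
    sin (k.+1%:R * pi * a) -
   (cos (2%:R * pi * a) * sine1 n.+1 + beta1 * sine_base n.+1 * sin (1%:R * pi * a) +
    sumr (fun j => beta j * (sine_hyp j n.+1 * sin ((2 * j + 3)%N%:R * pi * a)))) *
    sin (k.+1%:R * pi * a))); last first.
    move=> a a01; rewrite -sine_coef_snd// -sine_coef_fst// -mulrBl; congr (_ * _).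
    rewrite -I01B; [|by apply: C01M => //; exact: cj|by apply: C01M => //; exact: cj'].
    by apply: eq_I01 => b _; rewrite /u/= mulrBl.
  rewrite I01B ?double_coef_snd ?double_coef_fst ?(@double_coef_sym n.+1) ?subrr//.
    apply: C01M => //; apply: C01D.
      apply: C01D; first exact: C01_cst.
      apply: C01M; last exact: C01_cst.
      by apply: C01M; [exact: C01_cst|exact: C01_base].
    apply: C01_beta_sumr => [j|j b b01]; first by apply: C01M; [exact: C01_hyp|exact: C01_cst].
    by apply: normr_mul_le1; [exact: normr_hyp0|exact: normr_half_delta].
  apply: C01M => //; apply: C01D.
    apply: C01D; first by apply: C01M; [exact: C01_cosM|exact: C01_cst].
    by apply: C01M => //; exact: C01_cst.
  apply: C01_beta_sumr => [j|j b b01]; first by apply: C01M => //; exact: C01_cst.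
  by apply: normr_mul_le1; [exact: normr_sine_hyp|exact: sin_max].
move=> x01 y01; apply/eqP; rewrite -subr_eq0; apply/eqP; move: y y01.
apply: (sine_complete (g := fun y => u (x, y))); last by move=> n; exact: D0.
exact: C01_slice_closed.
Qed.

End Symmetry.

(** * Sign of the normal derivative on a horizontal side *)

Section Slopes.
Context {R : realType}.
Implicit Types (x y : R).

Lemma derive_gt0_right (g : R -> R) (a d : R) : is_derive a 1 g d -> 0 < d ->
  \forall h \near (0 : R)^'+, g a < g (h + a).
Proof.
move=> [dg gd] d0.
have : h^-1 *: (g (h *: 1 + a) - g a) @[h --> (0 : R)^'] --> d.
  by rewrite -gd; exact: dg.
move=> /cvgrPdist_lt/(_ _ d0) H.
have sub : (0 : R)^'+ `=>` (0 : R)^'.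
  by apply: within_subset => h /= h0; rewrite gt_eqF.
have H' : \forall h \near (0 : R)^'+, `|d - h^-1 *: (g (h *: 1 + a) - g a)| < d.
  exact: sub.
have h0 := @nbhs_right_gt R 0.
apply: filterS2 H' h0 => h; rewrite scaler1 => /ltr_normlW hd h0.
have : 0 < h^-1 * (g (h + a) - g a) by move: hd; rewrite /GRing.scale/=; lra.
by rewrite pmulr_rgt0 ?invr_gt0// subr_gt0.
Qed.

Lemma sol_slope x : x \in `]0, 1[ ->
  sol 0 1 x 0 = 16 / 3 * base 0 x - 16 * sumr (fun j => tau j * hyp 0 (decay j) x).
Proof.
move=> x01; have p0 : pi != 0 :> R by rewrite gt_eqF ?pi_gt0.
have pi2 : pi / 2 + pi / 2 = pi :> R by field.
rewrite /sol /wave !mulr0 !add0r !mul1r pi2 sinpi mulr0 add0r !expr1 sin_pihalf mulr1.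
congr (_ + _).
  by rewrite /beta1; move: (pi : R) p0 (base 0 x) => P P0 b; field.
rewrite -mulNr -sumrZ; last first.
  apply: (dominated_cvg_series is_cvg_series_tau) => j.
  rewrite normrM ger0_norm ?(ltW (tau_gt0 j))// ler_piMr ?(ltW (tau_gt0 j))//.
  by apply: normr_hyp0; exact: subset_itv_oo_cc.
congr sumr; apply/funext => j; rewrite /mode /wave !mulr0 !add0r mul1r expr1 sin_pihalf mulr1.
have f0 : freq j != 0 :> R by rewrite gt_eqF//; have := @freq_ge3 R j; lra.
rewrite /beta; move: (freq j) (tau j) (pi : R) p0 f0 => F T P P0 F0; field.
by rewrite P0 F0.
Qed.

(** In the middle the oscillating profile is negative, and the other modes
    have negative coefficients. *)
Lemma sol_slope_mid : sol 0 1 (1 / 2) 0 < 0 :> R.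
Proof.
have x01 : (1 / 2 : R) \in `]0, 1[ by rewrite in_itv/=; apply/andP; split; lra.
rewrite sol_slope// baseE subrr mulr0 cos0 mul1r.
have c0 : (cos (base_rate / 2))^-1 < 0 :> R by rewrite invr_lt0 cos_base_rate_lt0.
have u0 j : 0 <= tau j * hyp 0 (decay j) (1 / 2) :> R.
  by rewrite mulr_ge0 ?ltW ?tau_gt0 ?hyp_gt0.
have cu : cvgn (series (fun j => tau j * hyp 0 (decay j) (1 / 2 : R))).
  apply: (dominated_cvg_series is_cvg_series_tau) => j.
  rewrite normrM ger0_norm ?(ltW (tau_gt0 j))// ler_piMr ?(ltW (tau_gt0 j))//.
  by apply: normr_hyp0; exact: subset_itv_oo_cc.
have := sumr_ge_head u0 cu; have := u0 0%N; move: (sumr _) c0 => S.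
move: (tau 0 * _) (_^-1) => a b; lra.
Qed.

(** At t = pi / 6, sin t = cos (2 t) = 1 - 2 (sin t)^2. *)
Lemma sin_pi6 : sin (pi / 6) = 1 / 2 :> R.
Proof.
have p0 := pi_gt0 R.
have s0 : 0 < sin (pi / 6) :> R by apply: sin_gt0_pi; apply/andP; split; lra.
have e1 : cos (pi / 6 *+ 2) = sin (pi / 6) :> R.
  rewrite -[LHS]cosN -[RHS]cosBpihalf (_ : - (pi / 6 *+ 2) = pi / 6 - pi / 2)//.
  by rewrite -mulr_natr; lra.
have e2 : sin (pi / 6) = 1 - 2 * sin (pi / 6) ^+ 2 :> R.
  by rewrite -{1}e1 cos_mulr2n cos2sin2; ring.
have : (2 * sin (pi / 6) - 1) * (sin (pi / 6) + 1) = 0 :> R.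
  by move: e2; set s := sin _ => e2; lra.
move/eqP; rewrite mulf_eq0 => /orP[/eqP|/eqP]; lra.
Qed.

(** The slope at 0 is - sqrt 3 pi tan b with b = pi - base_rate / 2, and b <
    pi / 6 gives tan b < 1 / sqrt 3. *)
Lemma base_slope_gt : - pi < base 1 0 :> R.
Proof.
have p0 := pi_gt0 R; have /andP[s1 s2] := @sqrt3_bounds R.
have c0 := @cos_base_rate_lt0 R.
have s3 : Num.sqrt 3 ^+ 2 = 3 :> R by rewrite sqr_sqrtr ?ler0n.
pose b : R := pi - base_rate / 2.
have bE : b = pi * (1 - Num.sqrt 3 / 2) by rewrite /b /base_rate; field.
have b6 : b < pi / 6 by rewrite bE; nra.
have b0 : 0 < b by rewrite bE; nra.
have sb : sin (base_rate / 2) = sin b by rewrite /b sinB sinpi cospi; ring.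
have cb : cos (base_rate / 2) = - cos b by rewrite /b cosB sinpi cospi; ring.
have sb2 : sin b < 1 / 2.
  by rewrite -sin_pi6 ltr_sin// in_itv/=; apply/andP; split; lra.
have sb0 : 0 < sin b by apply: sin_gt0_pi; apply/andP; split; lra.
have cb0 : 0 < cos b by move: c0; rewrite cb; lra.
have key : Num.sqrt 3 * sin b < cos b.
  have := cos2Dsin2 b; nra.
rewrite /base /wave mulr0 add0r mul1r expr1.
have -> : pi / 2 - base_rate / 2 + pi / 2 = b by rewrite /b; field.
rewrite cb invrN mulrN ltrN2 ltr_pdivrMr// /base_rate -mulrA mulrCA.
by rewrite ltr_pM2l.
Qed.

(** The slope at 0 is - k tanh (k / 2) with k = sqrt 5 pi. Here sqrt 5 > 2 and
    e^(- k) <= 1 / 16 are precise enough. *)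
Lemma hyp_slope_lt : hyp 1 (decay 0) 0 < - (5 * pi / 3) :> R.
Proof.
have p2 := @pi_ge2 R.
have s0 : 0 <= Num.sqrt 5 :> R by exact: sqrtr_ge0.
have s5 : Num.sqrt 5 ^+ 2 = 5 :> R by rewrite sqr_sqrtr ?ler0n.
have s2 : 2 < Num.sqrt 5 :> R by nra.
have kE : decay 0 = pi * Num.sqrt 5 :> R.
  by rewrite /decay freqE mulr0 add0r; congr (_ * Num.sqrt _); ring.
have k4 : 4 <= decay 0 :> R by rewrite kE; nra.
have q16 : expR (- decay 0) <= 16^-1 :> R.
  rewrite expRN lef_pV2 ?posrE ?expR_gt0//.
  have e4 : expR 4 = expR 1 ^+ 4 :> R by rewrite -expRM_natl mulr1.
  have e1 : 2 <= expR 1 :> R by have := expR_ge1Dx (1 : R); lra.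
  apply: (@le_trans _ _ (expR 4)); last by rewrite ler_expR.
  rewrite e4; apply: (@le_trans _ _ (2 ^+ 4)); first by rewrite -natrX ler_nat.
  by rewrite lerXn2r ?nnegrE ?expR_ge0//; lra.
have q0 := expR_gt0 (- decay 0 : R).
rewrite /hyp subr0 mulr1 mulr0 oppr0 expR0 !expr1 mulr1.
rewrite ltr_pdivrMr ?addr_gt0// kE.
move: q16 q0; rewrite kE; move: (expR _) => q q1 q0.
move: (pi : R) (Num.sqrt 5) p2 s2 {s0 s5 kE k4} => P S P2 S2.
have h : 0 < S * (1 - q) - 5 / 3 * (1 + q) by nra.
have : 0 < P * (S * (1 - q) - 5 / 3 * (1 + q)) by rewrite mulr_gt0//; lra.
nra.
Qed.

(** The series of tau has sum 1 / 3, and each factor hyp only decreases its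
    term; the decrease of the first term alone is kept. *)
Lemma sumr_tau_hyp_le x : x \in `[0, 1] ->
  sumr (fun j => tau j * hyp 0 (decay j) x) <= 3^-1 - (1 - hyp 0 (decay 0) x) / 5.
Proof.
move=> x01.
have cu (u : nat -> R) : (forall j, `|u j| <= 1) -> cvgn (series (fun j => tau j * u j)).
  move=> u1; apply: (dominated_cvg_series is_cvg_series_tau) => j.
  by rewrite normrM ger0_norm ?(ltW (tau_gt0 j))// ler_piMr ?(ltW (tau_gt0 j)).
have c1 : cvgn (series (fun j => tau j * hyp 0 (decay j) x)).
  by apply: cu => j; exact: normr_hyp0.
have h1 j : 0 <= 1 - hyp 0 (decay j) x by rewrite subr_ge0 hyp_le1 ?decay_ge0.
have c2 : cvgn (series (fun j => tau j * (1 - hyp 0 (decay j) x))).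
  apply: cu => j; rewrite ger0_norm//; have := hyp_gt0 (decay j) x; lra.
have e : sumr (fun j => tau j * hyp 0 (decay j) x) +
    sumr (fun j => tau j * (1 - hyp 0 (decay j) x)) = 3^-1.
  rewrite -sumrD// -sumr_tau; congr sumr; apply/funext => j; ring.
have := sumr_ge_head (fun j => mulr_ge0 (ltW (tau_gt0 j)) (h1 j)) c2.
have -> : tau 0 = 5^-1 :> R by rewrite /tau freqE mulr0 add0r; congr (_^-1); ring.
move: e; lra.
Qed.

(** The slope is at least 16 (g (x) - g (0)), where g = base / 3 - hyp / 5
    with the first hyperbolic profile. By the two bounds above, g' (0) > - pi
    / 3 + pi / 3 = 0. *)
Lemma sol_slope_left : exists x, [/\ 0 < x, x < 1 / 2 & 0 < sol 0 1 x 0 :> R].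
Proof.
pose g (x : R) := 3^-1 * base 0 x + - (5^-1 * hyp 0 (decay 0) x).
have dg : is_derive (0 : R) 1 g (3^-1 * base 1 0 + - (5^-1 * hyp 1 (decay 0) 0)).
  have h1 := is_derive_scale 3^-1 (is_derive_base 0 (0 : R)).
  have h2 := is_derive_scale 5^-1 (is_derive_hyp 0 (decay 0) (0 : R)).
  exact: (is_derive_add h1 (is_derive_opp h2)).
have dpos : 0 < 3^-1 * base 1 0 + - (5^-1 * hyp 1 (decay 0) 0) :> R.
  have := base_slope_gt; have := hyp_slope_lt; lra.
have H := derive_gt0_right dg dpos.
have H0 := @nbhs_right_gt R 0.
have H1 : \forall x \near (0 : R)^'+, x < 1 / 2 by apply: nbhs_right_lt; lra.
have [x [[gx x0] x2]] := filter_ex (filterI (filterI H H0) H1).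
exists x; split => //.
have x01 : x \in `]0, 1[ by rewrite in_itv/=; apply/andP; split; lra.
rewrite sol_slope//.
have := sumr_tau_hyp_le (subset_itv_oo_cc x01).
move: gx; rewrite addr0 /g base00 hyp00.
by move: (base 0 x) (hyp 0 (decay 0) x) (sumr _) => B Y S; lra.
Qed.

End Slopes.

(** * The eigenfunction of the jump process *)

Section JumpEigenfunction.
Context {R : realType}.
Implicit Types (x y : R).

Definition jump_profile (z : R * R) : R := sol 0 0 z.1 z.2.

Lemma is_derive_unique_near (g h : R -> R) x dg dh :
  (\forall t \near x, g t = h t) -> is_derive x 1 g dg -> is_derive x 1 h dh -> dg = dh.
Proof.
move=> gh [_ <-] [_ <-]; exact: near_eq_derive.
Qed.

(** One more differentiation of the symmetry relation: a derivative in x on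
    one side is a derivative in y on the other. *)
Lemma sol_swap_deriv (i l i' l' : nat) :
  (forall x y, x \in `]0, 1[ -> y \in `]0, 1[ -> sol i l x y = sol i' l' y x) ->
  forall x y, x \in `]0, 1[ -> y \in `]0, 1[ -> sol i.+1 l x y = sol i' l'.+1 y x.
Proof.
move=> E x y x01 y01.
have nE : \forall t \near x, sol i l t y = sol i' l' y t.
  by apply: filterS (near_in_itvoo x01) => t t01; exact: E.
exact: (is_derive_unique_near nE (is_derive_sol_x i l y x01) (is_derive_sol_y i' l' x y01)).
Qed.

Lemma sol_swap10 x y : x \in `]0, 1[ -> y \in `]0, 1[ -> sol 1 0 x y = sol 0 1 y x.
Proof. by apply: sol_swap_deriv => a b ? ?; apply: sol_sym; exact: subset_itv_oo_cc. Qed.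

Lemma sol_swap20 x y : x \in `]0, 1[ -> y \in `]0, 1[ -> sol 2 0 x y = sol 0 2 y x.
Proof. by apply: sol_swap_deriv; exact: sol_swap10. Qed.

Lemma sol_swap11 x y : x \in `]0, 1[ -> y \in `]0, 1[ -> sol 1 1 x y = sol 1 1 y x.
Proof.
apply: (@sol_swap_deriv 0 1 1 0) => a b a01 b01.
by rewrite -sol_swap10.
Qed.

(** Around a point with 0 < x < 1 the derivatives of the solution are given by
    its series. The other points of the punctured square lie on the vertical
    sides, away from the vertices, and there the series with exchanged
    coordinates is used. *)
Definition glue (g h : R -> R -> R) (z : R * R) : R :=
  if z.1 \in `]0, 1[ then g z.1 z.2 else h z.2 z.1.

Lemma within_continuous_glue (g h : R -> R -> R) :
  (forall z : R * R, z.1 \in `]0, 1[ -> {for z, continuous (fun z => g z.1 z.2)}) ->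
  (forall z : R * R, z.1 \in `]0, 1[ -> {for z, continuous (fun z => h z.1 z.2)}) ->
  (forall x y, x \in `]0, 1[ -> y \in `]0, 1[ -> g x y = h y x) ->
  {within punctured, continuous (glue g h)}.
Proof.
move=> cg ch gh; apply: continuous_in_subspaceT => z /set_mem [cz nz].
have near1 : z.1 \in `]0, 1[ -> \forall w \near z, w.1 \in `]0, 1[.
  move=> z1; have cf : fst @ z --> z.1 by exact: cvg_fst.
  by have := cf _ (near_in_itvoo z1).
have near2 : z.2 \in `]0, 1[ -> \forall w \near z, w.2 \in `]0, 1[.
  move=> z2; have cf : snd @ z --> z.2 by exact: cvg_snd.
  by have := cf _ (near_in_itvoo z2).
have [z1|z1] := boolP (z.1 \in `]0, 1[).
  have := cg _ z1; rewrite /prop_for /continuous_at {2}/glue z1.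
  apply: cvg_trans; apply: near_eq_cvg.
  by apply: filterS (near1 z1) => w w1; rewrite /glue w1.
have z2 : z.2 \in `]0, 1[.
  move: cz => /closure_squareP[/andP[a0 a1] /andP[b0 b1]].
  move: z1; rewrite !in_itv/= !lt_neqAle a0 a1 b0 b1 !andbT negb_and !negbK => z1.
  have z1' : z.1 = 0 \/ z.1 = 1 by case/orP: z1 => /eqP; [left|right].
  apply/andP; split; apply/eqP => z2; apply: nz; split => //=; [left|right] => //.
have := ch (z.2, z.1) z2; rewrite /prop_for /continuous_at {2}/glue (negbTE z1)/= => c.
have c2 : (fun w : R * R => h w.2 w.1) @ z --> h z.2 z.1.
  have sw : (fun w : R * R => (w.2, w.1)) @ z --> (z.2, z.1) by exact: (cvg_pair cvg_snd cvg_fst).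
  exact: (@cvg_comp _ _ _ (fun w : R * R => (w.2, w.1)) (fun w : R * R => h w.1 w.2) _ _ _ sw c).
apply: cvg_trans c2; apply: near_eq_cvg.
apply: filterS (near2 z2) => w w2; rewrite /glue.
by case: ifPn => // w1; rewrite gh.
Qed.

Lemma C2_jump_profile : C2_closure jump_profile /\
  forall z, square z -> laplacian jump_profile z = - (4 * pi ^+ 2) * jump_profile z.
Proof.
pose U (i : 'I_2) := if i == ord0 then glue (sol 1 0) (sol 0 1)
  else glue (sol 0 1) (sol 1 0).
pose V (i j : 'I_2) := if i == ord0 then
    (if j == ord0 then glue (sol 2 0) (sol 0 2) else glue (sol 1 1) (sol 1 1))
  else if j == ord0 then glue (sol 1 1) (sol 1 1) else glue (sol 0 2) (sol 2 0).
have glueE g h (z : R * R) : z.1 \in `]0, 1[ -> glue g h z = g z.1 z.2.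
  by rewrite /glue => ->.
have dx i l g h (z : R * R) : square z -> is_derive z (axis ord0) (glue (sol i l) g)
    (glue (sol i.+1 l) h z).
  case: z => x y [/= x01 y01]; rewrite glueE//.
  apply: (@near_eq_is_derive _ _ _ (fun z => sol i l z.1 z.2)).
    apply: filterS (near_square (_ : square (x, y))) => // w [w1 _].
    by rewrite glueE.
  by apply/is_derive_axis0; exact: is_derive_sol_x.
have dy i l g h (z : R * R) : square z -> is_derive z (axis ord_max) (glue (sol i l) g)
    (glue (sol i l.+1) h z).
  case: z => x y [/= x01 y01]; rewrite glueE//.
  apply: (@near_eq_is_derive _ _ _ (fun z => sol i l z.1 z.2)).
    apply: filterS (near_square (_ : square (x, y))) => // w [w1 _].
    by rewrite glueE.
  by apply/is_derive_axis1; exact: is_derive_sol_y.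
have du i z : square z -> is_derive z (axis i) jump_profile (U i z).
  case: z => x y [/= x01 y01]; case: (ord2P i) => ->; rewrite /U/= glueE//.
    by apply/is_derive_axis0; exact: is_derive_sol_x.
  by apply/is_derive_axis1; exact: is_derive_sol_y.
have [C2 lap] : C2_closure jump_profile /\ (forall z, square z ->
    laplacian jump_profile z = V ord0 ord0 z + V ord_max ord_max z).
  apply: (@C2_closureI _ jump_profile U V) => //.
  - exact: within_continuous_sol.
  - move=> i; case: (ord2P i) => ->; rewrite /U/=; apply: within_continuous_glue;
      try exact: continuous_sol; first exact: sol_swap10.
    by move=> a b a01 b01; rewrite sol_swap10.
  - by move=> i j z sz; case: (ord2P i) => ->; case: (ord2P j) => ->; rewrite /U /V/=;
      [exact: dx|exact: dy|exact: dx|exact: dy].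
  - move=> i j; case: (ord2P i) => ->; case: (ord2P j) => ->; rewrite /V/=;
      apply: within_continuous_glue; try exact: continuous_sol.
    + exact: sol_swap20.
    + exact: sol_swap11.
    + exact: sol_swap11.
    + by move=> a b a01 b01; rewrite sol_swap20.
split=> // z sz; have [z1 _] := sz.
by rewrite lap// /V/= !glueE// sol_helmholtz.
Qed.

(** On the vertical sides the value comes from the horizontal ones by
    symmetry. *)
Lemma jump_profile_boundary z : square_boundary z -> jump_profile z = 1.
Proof.
move=> bz; have [cz _] := bz.
have [z1 z2] : z.1 \in `[0, 1] /\ z.2 \in `[0, 1].
  by move: cz; rewrite square_closureE.
case: (boundaryP bz) => zE.
- by rewrite /jump_profile sol_sym// zE; apply: sol_boundary; left.
- by rewrite /jump_profile sol_sym// zE; apply: sol_boundary; right.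
- by rewrite /jump_profile zE; apply: sol_boundary; left.
- by rewrite /jump_profile zE; apply: sol_boundary; right.
Qed.

(** The slopes at the bottom side have opposite signs at two abscissas, so
    just above that side the solution is greater than 1 at one of them and
    less than 1 at the other. *)
Lemma jump_profile_attains1 : exists z, square z /\ jump_profile z = 1.
Proof.
have m01 : (1 / 2 : R) \in `]0, 1[ by rewrite in_itv/=; apply/andP; split; lra.
have [a [a0 a2 sa]] := @sol_slope_left R.
have a01 : a \in `]0, 1[ by rewrite in_itv/=; apply/andP; split; lra.
have b0 (x : R) : sol 0 0 x 0 = 1 by apply: sol_boundary; left.
have H1 := derive_gt0_right (is_derive_sol_y 0 0 0 a01) sa.
have sm : 0 < - sol 0 1 (1 / 2) 0 :> R by rewrite oppr_gt0; exact: sol_slope_mid.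
have H2 := derive_gt0_right (is_derive_opp (is_derive_sol_y 0 0 0 m01)) sm.
have H0 := @nbhs_right_gt R 0.
have H3 : \forall x \near (0 : R)^'+, x < 1 by exact: nbhs_right_lt.
have [y [[y1 y2] [y0 y3]]] := filter_ex (filterI (filterI H1 H2) (filterI H0 H3)).
move: y1 y2; rewrite !addr0 !b0 ltrN2 => y1 y2.
have sub x : x \in `[a, (1 / 2)] -> x \in `]0, 1[.
  by rewrite !in_itv/= => /andP[? ?]; apply/andP; split; lra.
have cf : {within `[a, (1 / 2)], continuous (fun x => sol 0 0 x y)}.
  apply: derivable_within_continuous => x xI.
  by have [] := is_derive_sol_x 0 0 y (sub _ xI).
have [] := @IVT R (fun x => sol 0 0 x y) a (1 / 2) 1 (ltW a2) cf.
  by rewrite ge_min le_max (ltW y1) (ltW y2) orbT.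
move=> x xI xE; exists (x, y); split => //; split; first exact: sub.
by rewrite /= in_itv/= y0 y3.
Qed.

(** The solution is a pointwise limit of sums of products of functions of one
    coordinate. *)
Lemma measurable_jump_profile : measurable_fun square jump_profile.
Proof.
have mc (p : R -> R) : continuous p -> measurable_fun setT p.
  exact: continuous_measurable_fun.
have mp (p q : R -> R) : continuous p -> continuous q ->
    measurable_fun square (fun z : R * R => p z.1 * q z.2).
  move=> cp cq; apply: measurable_funTS; apply: measurable_funM.
    by apply: measurableT_comp => //; exact: mc.
  by apply: measurableT_comp => //; exact: mc.
have mm j : measurable_fun square (fun z : R * R => mode 0 0 j z.1 z.2).
  apply: (mp (fun x => beta j * hyp 0 (decay j) x) (wave 0 (freq j * pi) 0)).
    by move=> x; apply: cvgM; [exact: cvg_cst|exact: continuous_hyp].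
  exact: continuous_wave.
rewrite /jump_profile /sol; apply: measurable_funD.
  apply: measurable_funD.
    by apply: measurable_funTS; apply: measurableT_comp => //; apply: mc; exact: continuous_wave.
  apply: (mp (fun x => beta1 * base 0 x) (wave 0 pi 0)); last exact: continuous_wave.
  move=> x; apply: cvgM; first exact: cvg_cst.
  exact: (is_derive_continuous (is_derive_base 0)).
apply: (@measurable_fun_cvg _ _ _ square (fun n z => series (fun j => mode 0 0 j z.1 z.2) n)).
  elim=> [|n IH].
    by under eq_fun do rewrite /series/= big_geq//; exact: measurable_cst.
  by under eq_fun do rewrite seriesSr; exact: measurable_funD.
by move=> z [z1 _]; exact: cvg_modes.
Qed.

End JumpEigenfunction.

Section Gamma.
Context {R : realType}.
Local Open Scope complex_scope.

(** Integrating against the point mass is evaluation at x0, where the function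
    takes its boundary value. *)
Lemma jump_eigenvalue_dirac (x0 : R * R) : square x0 -> jump_profile x0 = 1 ->
  jump_eigenvalue (\d_x0) (- (2 * pi ^+ 2) : R)%:C.
Proof.
move=> sx0 ux0; have [C2u lapu] := @C2_jump_profile R.
have msq : measurable (@square R) by apply: measurableX; exact: measurable_itv.
exists (fun z => (jump_profile z)%:C); split.
- split; first by split; [exact: C2u|exact: (C2_cst 0)].
  move=> z bz; rewrite jump_profile_boundary// /integralC.
  have -> : Rintegral (\d_x0) square (reC (fun z : R * R => (jump_profile z)%:C)) = 1.
    rewrite /Rintegral integral_dirac//; last first.
      by apply/measurable_EFinP; exact: measurable_jump_profile.
    by rewrite diracE mem_set// /= mul1r.
  have -> : Rintegral (\d_x0) square (imC (fun z : R * R => (jump_profile z)%:C)) = 0.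
    by rewrite /Rintegral integral0_eq.
  by [].
- exists x0; last by rewrite ux0 oner_neq0.
  exact: subset_closure.
- apply/half_laplacian_realP; split => z sz.
    by rewrite [reC _](_ : _ = jump_profile)// lapu//; field.
  rewrite [imC _](_ : _ = fun=> 0); last exact/funext.
  by rewrite laplacian_cst !mulr0.
Qed.

End Gamma.

Theorem proposition3 (R : realType) (lamD : nat -> R)
    (HlamD : dirichlet_eigenvalues lamD) :
  exists x0 : R * R,
    [/\ square x0, ((lamD 1%N)%:E < gamma1 (\d_x0))%E
      & lamD 1%N = - (5 * pi ^+ 2 / 2)].
Proof.
have [x0 [sx0 ux0]] := @jump_profile_attains1 R.
exists x0; split => //; last exact: second_dirichlet_eigenvalue.
have p20 : 0 < pi ^+ 2 :> R by rewrite exprn_gt0// pi_gt0.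
rewrite second_dirichlet_eigenvalue//.
apply: (@lt_le_trans _ _ (- (2 * pi ^+ 2))%:E); first by rewrite lte_fin; lra.
apply: ereal_sup_ubound; exists (- (2 * pi ^+ 2))%:C%C => //.
split; last exact: jump_eigenvalue_dirac.
by rewrite fmorph_eq0 oppr_eq0 gt_eqF// mulr_gt0.
Qed.
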